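(* Let $0<q<1$, $\alpha=\frac{2q}{1-q}$, and let $t,l>0$ be real. Let $p\ge1$ be an integer, let $a_1,\dots,a_p\in\{-\frac12,\frac12\}$ and $s_1,\dots,s_p\in\mathbb N$ be fixed. Let the nonnegative integer $T$ depend on $N$ in such a way that $T/N\to t$ as $N\to\infty$, and let the positive integers $r_1,\dots,r_p$ depend on $N$ in such a way that $r_i/N\to l$ for every $i$ while the differences $r_i-r_j$ are fixed finite constants. Set $k_j=2r_j+a_j-\frac12$, and assume the points $(s_1,k_1),\dots,(s_p,k_p)$ are pairwise distinct. Let $$\theta=1+\frac{2l}{(l-t)(2\alpha+\alpha^2)}.$$ Then $$\lim_{N\to\infty}\det\big[K_T((s_i,k_i),(s_j,k_j))\big]_{i,j=1}^p=\begin{cases}1,& l\ge(1-(1+\alpha)^{-2})t,\\[2pt] \det\big[L(r_i,a_i,s_i,r_j,a_j,s_j,\tfrac12;\theta)\big]_{i,j=1}^p,& l<(1-(1+\alpha)^{-2})t.\end{cases}$$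
   Context: $\mathbb N=\{0,1,2,\dots\}$. For $k\ge1$ let $r_k=\lfloor\frac{k+1}{2}\rfloor$, and let $a_k=-\frac12$ if $k$ is odd, $a_k=\frac12$ if $k$ is even, so that $2r_k+a_k-\frac12=k$. (In the claim, $r_j$ and $a_j$ are therefore the values of these quantities at the level $k_j$.) For $n\in\mathbb N$ the Jacobi polynomials $J_{n,\pm1/2}$ are the polynomials determined by $$J_{n,1/2}\Big(\frac{z+z^{-1}}2\Big)=\frac{z^{n+1}-z^{-(n+1)}}{z-z^{-1}},\qquad J_{n,-1/2}\Big(\frac{z+z^{-1}}2\Big)=\frac{z^{n+1/2}+z^{-(n+1/2)}}{z^{1/2}+z^{-1/2}}.$$ Let $$\phi(x)=\frac1{1+\alpha(1-x)+\frac{\alpha^2}2(1-x)},$$ so $1/\phi$ is a polynomial. For $s,s'\in\mathbb N$, $k,m\ge1$ and a nonnegative integer $T$, the correlation kernel is $$K_T((s,k),(s',m))=\frac{2^{a_k+1/2}}{\pi}\frac1{2\pi i}\int_{-1}^1\oint\frac{\phi(x)^T}{\phi(u)^T}J_{s,a_k}(x)J_{s',a_m}(u)\frac{(1-x)^{r_k}}{(1-u)^{r_m}}\frac{(1-x)^{a_k}(1+x)^{1/2}}{x-u}\,du\,dx$$ $$\qquad+1_{k\ge m}\frac{2^{a_k+1/2}}{\pi}\int_{-1}^1J_{s,a_k}(x)J_{s',a_m}(x)(1-x)^{r_k-r_m+a_k}(1+x)^{1/2}\,dx,$$ where the $u$-contour is a positively oriented simple closed curve encircling $[-1,1]$. The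 discrete Jacobi kernel, for $-1<u<1$ and $a_1,a_2=\pm\frac12$, is defined as follows. If $2r_1+a_1\ge2r_2+a_2$, $$L(r_1,a_1,s_1,r_2,a_2,s_2,b;u)=\frac{2^{a_1+1/2}}{\pi}\int_u^1J_{s_1,a_1}(x)J_{s_2,a_2}(x)(x-1)^{r_1-r_2}(1-x)^{a_1}(1+x)^b\,dx,$$ and if $2r_1+a_1<2r_2+a_2$, $$L(r_1,a_1,s_1,r_2,a_2,s_2,b;u)=-\frac{2^{a_1+1/2}}{\pi}\int_{-1}^uJ_{s_1,a_1}(x)J_{s_2,a_2}(x)(x-1)^{r_1-r_2}(1-x)^{a_1}(1+x)^b\,dx.$$ It depends on $r_1,r_2$ only through $r_1-r_2$. The quantity $\theta$ is used only when $l<(1-(1+\alpha)^{-2})t$, in which case $-1<\theta<1$. *)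

(* Defs.v *)
From HB Require Import structures.
From mathcomp Require Import all_boot all_order all_algebra.
From mathcomp Require Import all_classical all_reals all_analysis.
From mathcomp Require Import complex ring lra.
Set Implicit Arguments.
Unset Strict Implicit.
Unset Printing Implicit Defensive.
Import Order.TTheory GRing.Theory Num.Theory.
Import numFieldNormedType.Exports.
Local Open Scope classical_set_scope.
Local Open Scope ring_scope.
Local Open Scope complex_scope.

Definition polyC_eval (R : realType) (P : {poly R}) (u : R[i]) : R[i] :=
  (map_poly (real_complex R) P).[u].

(* For a = -1/2 the variable w stands for z^{1/2}, so that z = w ^+ 2 and both
   square roots of z are covered. *)
Definition jacobi_spec (R : realType) (n : nat) (a : R) (P : {poly R}) : Prop :=
  (a = 1 / 2 -> forall z : R[i], z != 0 -> z - z^-1 != 0 ->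
     polyC_eval P ((z + z^-1) / 2) = (z ^+ n.+1 - z ^- n.+1) / (z - z^-1)) /\
  (a = - (1 / 2) -> forall w : R[i], w != 0 -> w + w^-1 != 0 ->
     polyC_eval P ((w ^+ 2 + w ^- 2) / 2) =
       (w ^+ (2 * n).+1 + w ^- (2 * n).+1) / (w + w^-1)).

(* Only meaningful for a = 1/2 and a = -1/2; existence, uniqueness and the
   recurrence are [jacobiP], [jacobi_unique], [jacobi_rec]. *)
Definition jacobi (R : realType) (n : nat) (a : R) : {poly R} :=
  xget 0 [set P | jacobi_spec n a P].

Section JacobiFacts.
Variable R : realType.
Implicit Types (P Q : {poly R}) (a : R).

Fixpoint jacobi_pair (P1 : {poly R}) (n : nat) : {poly R} * {poly R} :=
  if n is m.+1 then
    let: (P, Q) := jacobi_pair P1 m in (Q, 2%:P * 'X * Q - P)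
  else (1, P1).

Definition jacobi_step a : {poly R} :=
  if a == 1 / 2 then 2%:P * 'X else 2%:P * 'X - 1.

Definition jacobi_rec_poly (n : nat) a : {poly R} :=
  (jacobi_pair (jacobi_step a) n).1.

Lemma jacobi_rec_polySS n a :
  jacobi_rec_poly n.+2 a =
  2%:P * 'X * jacobi_rec_poly n.+1 a - jacobi_rec_poly n a.
Proof.
by rewrite /jacobi_rec_poly /=; case: (jacobi_pair _ n) => P Q /=.
Qed.

Lemma polyC_evalB P Q u : polyC_eval (P - Q) u = polyC_eval P u - polyC_eval Q u.
Proof. by rewrite /polyC_eval rmorphB hornerD hornerN. Qed.

Lemma polyC_eval2X P u : polyC_eval (2%:P * 'X * P) u = 2 * u * polyC_eval P u.
Proof.
by rewrite /polyC_eval !rmorphM /= map_polyX map_polyC /= !hornerE rmorph_nat.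
Qed.

Lemma polyC_eval1 u : polyC_eval (1 : {poly R}) u = 1.
Proof. by rewrite /polyC_eval rmorph1 hornerE. Qed.

Lemma jacobi_rec_polyP n a : jacobi_spec n a (jacobi_rec_poly n a).
Proof.
split=> aE z z0 zz; rewrite {}aE.
- suff [] : polyC_eval (jacobi_rec_poly n (1 / 2)) ((z + z^-1) / 2) =
      (z ^+ n.+1 - z ^- n.+1) / (z - z^-1) /\
    polyC_eval (jacobi_rec_poly n.+1 (1 / 2)) ((z + z^-1) / 2) =
      (z ^+ n.+2 - z ^- n.+2) / (z - z^-1) by [].
  have zz' : z * z - 1 != 0.
    apply: contra zz => /eqP h.
    by rewrite -(mulfK z0 (z - z^-1)) mulrBl mulVf // h mul0r.
  elim: n => [|n [IH1 IH2]]; last first.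
    split=> //; rewrite jacobi_rec_polySS polyC_evalB polyC_eval2X IH1 IH2.
    rewrite !exprS; have : z ^+ n != 0 by rewrite expf_neq0.
    move: (z ^+ n) => Z Z0; field; do ?[apply/andP; split] => //.
  split; first by rewrite /jacobi_rec_poly /= polyC_eval1 expr1 divff.
  rewrite /jacobi_rec_poly /= /jacobi_step eqxx.
  rewrite -[2%:P * 'X]mulr1 polyC_eval2X polyC_eval1 !exprS expr0; field.
  by do ?[apply/andP; split] => //.
- suff [] : polyC_eval (jacobi_rec_poly n (- (1 / 2))) ((z ^+ 2 + z ^- 2) / 2) =
      (z ^+ (2 * n).+1 + z ^- (2 * n).+1) / (z + z^-1) /\
    polyC_eval (jacobi_rec_poly n.+1 (- (1 / 2))) ((z ^+ 2 + z ^- 2) / 2) =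
      (z ^+ (2 * n.+1).+1 + z ^- (2 * n.+1).+1) / (z + z^-1) by [].
  have zz' : z * z + 1 != 0.
    apply: contra zz => /eqP h.
    by rewrite -(mulfK z0 (z + z^-1)) mulrDl mulVf // h mul0r.
  elim: n => [|n [IH1 IH2]]; last first.
    split=> //; rewrite jacobi_rec_polySS polyC_evalB polyC_eval2X IH1 IH2.
    rewrite !mulnS !addSn !add0n !exprS.
    have : z ^+ (2 * n) != 0 by rewrite expf_neq0.
    move: (z ^+ (2 * n)) => Z Z0; rewrite expr0; field; do ?[apply/andP; split] => //.
  split; first by rewrite /jacobi_rec_poly /= polyC_eval1 muln0 expr1 divff.
  rewrite /jacobi_rec_poly /= /jacobi_step.
  have /negPf-> : - (1 / 2) != 1 / 2 :> R by apply/eqP => h; lra.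
  rewrite polyC_evalB -[2%:P * 'X]mulr1 polyC_eval2X polyC_eval1.
  rewrite muln1 !exprS expr0; field.
  by do ?[apply/andP; split] => //.
Qed.

Lemma jacobiP n a : jacobi_spec n a (jacobi n a).
Proof. exact: (xgetPex 0 (ex_intro _ _ (jacobi_rec_polyP n a))). Qed.

Let node (m : nat) : R := ((m.+2)%:R ^+ 2 + (m.+2)%:R ^- 2) / 2.

Let node_inj : injective node.
Proof.
have ge2 k : 2 <= (k.+2)%:R :> R by rewrite ler_nat.
move=> i j; rewrite /node => h; apply/eqP.
rewrite -[i == j]/(i.+2 == j.+2) -(eqr_nat R); move: (ge2 i) (ge2 j) h.
move: (i.+2)%:R (j.+2)%:R => x y x2 y2 h.
have x0 : x != 0 by apply/eqP; lra.
have y0 : y != 0 by apply/eqP; lra.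
have : (x - y) * ((x + y) * (x ^+ 2 * y ^+ 2 - 1)) = 0.
  have : x ^+ 2 * y ^+ 2 * 2 * ((x ^+ 2 + x ^- 2) / 2) =
         x ^+ 2 * y ^+ 2 * 2 * ((y ^+ 2 + y ^- 2) / 2) by rewrite h.
  have -> : x ^+ 2 * y ^+ 2 * 2 * ((x ^+ 2 + x ^- 2) / 2) =
            x ^+ 4 * y ^+ 2 + y ^+ 2 by field.
  have -> : x ^+ 2 * y ^+ 2 * 2 * ((y ^+ 2 + y ^- 2) / 2) =
            x ^+ 2 * y ^+ 4 + x ^+ 2 by field.
  move=> e; transitivity (x ^+ 4 * y ^+ 2 + y ^+ 2 - (x ^+ 2 * y ^+ 4 + x ^+ 2)).
    by ring.
  by rewrite e subrr.
move/eqP; rewrite mulf_eq0 subr_eq0 => /orP[//|]; apply: contraTT => _.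
rewrite mulf_neq0 //; first by apply/eqP; lra.
have x4 : 4 <= x ^+ 2 by rewrite expr2; nra.
have y4 : 4 <= y ^+ 2 by rewrite expr2; nra.
by apply/eqP; nra.
Qed.

Let eq_on_nodes P Q : (forall m, P.[node m] = Q.[node m]) -> P = Q.
Proof.
move=> h; apply/eqP; rewrite -subr_eq0; apply/negP => /negP n0.
have := max_poly_roots (rs := map node (iota 0 (size (P - Q)))) n0.
rewrite size_map size_iota ltnn => H; apply: notF; apply: H.
  by apply/allP => _ /mapP[m _ ->]; rewrite /root !hornerE h subrr.
by rewrite map_inj_uniq ?iota_uniq.
Qed.

Lemma jacobi_unique n a P : a = 1 / 2 \/ a = - (1 / 2) ->
  jacobi_spec n a P -> P = jacobi n a.
Proof.
move=> ha hP; have hJ := jacobiP n a; apply: eq_on_nodes => m.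
apply: (@complexI R); rewrite -!horner_map.
have pos : 2 <= (m.+2)%:R :> R by rewrite ler_nat.
have [n0 n1 n2] : [/\ (m.+2)%:R != 0 :> R,
    (m.+2)%:R ^+ 2 - ((m.+2)%:R ^+ 2)^-1 != 0 :> R &
    (m.+2)%:R + (m.+2)%:R^-1 != 0 :> R].
  move: pos; move: (m.+2)%:R => x x2; split.
  - by apply/eqP; lra.
  - rewrite subr_eq0; apply/eqP => h.
    have x4 : 4 <= x ^+ 2 by rewrite expr2; nra.
    have : x ^+ 2 * x ^+ 2 = 1 by rewrite {2}h mulfV //; apply/eqP; lra.
    by nra.
  - have xi : 0 < x^-1 by rewrite invr_gt0; lra.
    by apply/eqP; lra.
rewrite /node !rmorphM !rmorphD !fmorphV !rmorphXn /= !rmorph_nat.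
have m0 : (m.+2)%:R != 0 :> R[i] by rewrite pnatr_eq0.
case: ha => ha; [have [/(_ ha) P1 _] := hP; have [/(_ ha) J1 _] := hJ
  | have [_ /(_ ha) P1] := hP; have [_ /(_ ha) J1] := hJ].
- have e0 : (m.+2)%:R ^+ 2 != 0 :> R[i] by rewrite expf_neq0.
  have e1 : (m.+2)%:R ^+ 2 - ((m.+2)%:R ^+ 2)^-1 != 0 :> R[i].
    rewrite -(rmorph_nat (real_complex R)) -rmorphXn -fmorphV -rmorphB.
    by rewrite fmorph_eq0.
  by have := P1 _ e0 e1; rewrite /polyC_eval => ->; rewrite -J1.
- have e1 : (m.+2)%:R + (m.+2)%:R^-1 != 0 :> R[i].
    rewrite -(rmorph_nat (real_complex R)) -fmorphV -rmorphD.
    by rewrite fmorph_eq0.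
  by have := P1 _ m0 e1; rewrite /polyC_eval => ->; rewrite -J1.
Qed.

Lemma jacobi_rec n a : a = 1 / 2 \/ a = - (1 / 2) ->
  [/\ jacobi 0 a = 1,
      jacobi 1 a = (if a == 1 / 2 then 2%:P * 'X else 2%:P * 'X - 1) &
      jacobi n.+2 a = 2%:P * 'X * jacobi n.+1 a - jacobi n a].
Proof.
move=> ha; have E k : jacobi k a = jacobi_rec_poly k a.
  by apply/esym/jacobi_unique => //; exact: jacobi_rec_polyP.
by split; rewrite !E ?jacobi_rec_polySS.
Qed.

End JacobiFacts.

Definition cintegral (R : realType) (D : set R) (f : R -> R[i]) : R[i] :=
  (\int[lebesgue_measure]_(x in D) complex.Re (f x))%R +i*
  (\int[lebesgue_measure]_(x in D) complex.Im (f x))%R.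

(* f is C^1 on [c, d]: continuous on [c, d], differentiable on ]c, d[, and the
   derivative extends continuously to [c, d]. *)
Definition C1_on (R : realType) (f : R -> R) (c d : R) : Prop :=
  derivable_oo_LRcontinuous f c d /\
  exists2 g : R -> R, {within `[c, d], continuous g} &
    {in `]c, d[, f^`()%classic =1 g}.

Definition piecewise_C1 (R : realType) (f : R -> R) : Prop :=
  exists ts : seq R, [/\ path <%R 0 ts, last 0 ts = 1 &
    forall i, (i < size ts)%N ->
      C1_on f (nth 0 (0 :: ts) i) (nth 0 (0 :: ts) i.+1)].

(* The derivative of a piecewise C^1 curve exists off a finite set, hence almost
   everywhere. *)
Definition curve_deriv (R : realType) (gamma : R -> R[i]) (v : R) : R[i] :=
  (@complex.Re R \o gamma)^`()%classic v +i*
  (@complex.Im R \o gamma)^`()%classic v.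

Definition contour_integral (R : realType) (gamma : R -> R[i])
    (f : R[i] -> R[i]) : R[i] :=
  cintegral `[0, 1] (fun v => f (gamma v) * curve_deriv gamma v).

Definition two_pi_i (R : realType) : R[i] := 2 * (pi : R)%:C * 'i.

Definition winding_number (R : realType) (gamma : R -> R[i]) (z : R[i]) : R[i] :=
  (two_pi_i R)^-1 * contour_integral gamma (fun u => (u - z)^-1).

(* A piecewise C^1 simple closed curve, parametrized by [0, 1].  "Positively
   oriented and encircling [-1, 1]" is read as: the curve misses [-1, 1] and has
   winding number 1 about each of its points. *)
Definition encircling_contour (R : realType) (gamma : R -> R[i]) : Prop :=
  [/\ piecewise_C1 (@complex.Re R \o gamma),
      piecewise_C1 (@complex.Im R \o gamma),
      gamma 0 = gamma 1,
      {in `[0, 1[ &, injective gamma} &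
      forall x : R, -1 <= x <= 1 ->
        (forall v : R, 0 <= v <= 1 -> gamma v != x%:C) /\
        winding_number gamma x%:C = 1].

Definition phi (F : fieldType) (alpha x : F) : F :=
  1 / (1 + alpha * (1 - x) + alpha ^+ 2 / 2 * (1 - x)).

Definition level_r (k : nat) : nat := k.+1./2.

Definition level_a (R : realType) (k : nat) : R :=
  if odd k then - (1 / 2) else 1 / 2.

(* If 1/phi(u) = 0 the totalized field gives phi u = 0 and (phi u ^+ T)^-1 is the
   value at u of the polynomial (1/phi)^T, so no convention leaks in there. *)
Definition kernel_contour_integrand (R : realType) (alpha : R) (T : nat)
    (s k s' m : nat) (x : R) (u : R[i]) : R[i] :=
  (phi alpha x ^+ T)%:C / phi alpha%:C u ^+ T *
  (jacobi s (level_a R k)).[x]%:C *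
  polyC_eval (jacobi s' (level_a R m)) u *
  (((1 - x) ^+ level_r k)%:C / (1 - u) ^+ level_r m) *
  (((1 - x) `^ level_a R k * (1 + x) `^ (1 / 2))%:C / (x%:C - u)).

Definition correlation_kernel (R : realType) (alpha : R) (gamma : R -> R[i])
    (T : nat) (s k s' m : nat) : R[i] :=
  ((2 `^ (level_a R k + 1 / 2)) / pi)%:C * (two_pi_i R)^-1 *
    cintegral `[-1, 1] (fun x =>
      contour_integral gamma (kernel_contour_integrand alpha T s k s' m x)) +
  (if (m <= k)%N then
     (2 `^ (level_a R k + 1 / 2)) / pi *
     \int[lebesgue_measure]_(x in `[-1, 1])
       ((jacobi s (level_a R k)).[x] * (jacobi s' (level_a R m)).[x] *
        (1 - x) `^ ((level_r k)%:R - (level_r m)%:R + level_a R k) *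
        (1 + x) `^ (1 / 2))
   else 0)%:C.

Definition jacobi_kernel_integrand (R : realType) (r1 : int) (a1 : R) (s1 : nat)
    (r2 : int) (a2 : R) (s2 : nat) (b x : R) : R :=
  (jacobi s1 a1).[x] * (jacobi s2 a2).[x] * (x - 1) ^ (r1 - r2) *
  (1 - x) `^ a1 * (1 + x) `^ b.

Definition discrete_jacobi_kernel (R : realType) (r1 : int) (a1 : R) (s1 : nat)
    (r2 : int) (a2 : R) (s2 : nat) (b u : R) : R :=
  if 2 * r2%:~R + a2 <= 2 * r1%:~R + a1 then
    2 `^ (a1 + 1 / 2) / pi *
    \int[lebesgue_measure]_(x in `[u, 1])
      jacobi_kernel_integrand r1 a1 s1 r2 a2 s2 b x
  else
    - (2 `^ (a1 + 1 / 2) / pi) *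
    \int[lebesgue_measure]_(x in `[-1, u])
      jacobi_kernel_integrand r1 a1 s1 r2 a2 s2 b x.

(* Main.v *)
Require Import Defs.
From HB Require Import structures.
From mathcomp Require Import all_boot all_order all_algebra fingroup perm.
From mathcomp Require Import all_classical all_reals all_analysis.
From mathcomp Require Import measurable_realfun.
From mathcomp Require Import complex ring lra zify.
Set Implicit Arguments.
Unset Strict Implicit.
Unset Printing Implicit Defensive.
Import Order.TTheory GRing.Theory Num.Theory.
Import numFieldNormedType.Exports.
Local Open Scope classical_set_scope.
Local Open Scope ring_scope.
Local Open Scope complex_scope.

(** With y = 1 - x and c = alpha + alpha^2 / 2 one has 1 / phi = 1 + c y. Expanding
    J(u) / phi(u)^T in powers of 1 - u and using partial fractions, only the terms
    of degree at least r_m contribute to the contour integral, each by its value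
    at x. Up to elementary factors, phi(x)^T times such a truncation is the
    probability that a binomial variable with parameters T and c y / (1 + c y) is
    at least r_m - i. By Chebyshev's inequality it tends to 1 or 0 according to
    whether c y / (1 + c y) exceeds l / t or not, that is, whether x < theta or
    x > theta; the crude bound 2^T p^n on binomial tails provides domination.
    The limit matrix is that of the discrete Jacobi kernel, up to signs
    (-1)^(r_i - r_j) which conjugate away. When l is at least
    (1 - (1 + alpha)^-2) t, theta is effectively -1: the limit matrix vanishes for
    k_i < k_j and, by orthogonality of the Jacobi polynomials, is the identity on
    each block of equal k, so its determinant is 1. *)

(** * Calculus off a finite set *)

(** The contour is known only as a closed piecewise C^1 curve with winding number 1 about each point
    of [-1, 1]. Since 1 / phi is a polynomial, the integrand in u is a combination of terms (1 -
    u)^i / (x - u), with i of either sign, and each of these reduces to functions with an explicit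
    primitive, whose integral vanishes, and to the winding number itself; no general form of
    Cauchy's theorem enters. The other obstacle is the endpoint x = 1. For r_k < r_m the factor (1 -
    x)^(r_k - r_m) is singular there, so domination requires the tail probability to vanish at x = 1
    to order r_m - r_k, uniformly in N. Chebyshev's bound vanishes only to first order in y, whereas
    2^T p^n has order n, which eventually exceeds any fixed order. What remains is the weight (1 -
    x)^a, with a at worst -1/2, which is integrable. *)

Section FTC.
Variable R : realType.
Implicit Types (f g F : R -> R) (a b c x : R) (S : seq R).
Local Notation mu := (@lebesgue_measure R).

Lemma eq_of_derive0_off_seq S F a b : a <= b ->
  {within `[a, b], continuous F} ->
  (forall x, x \in `]a, b[ -> x \notin S ->
     derivable F x 1 /\ F^`()%classic x = 0) ->
  F b = F a.
Proof.
elim: S a b => [|s S IH] a b ab cF dF.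
  have [x xab|//|c _] := MVT_segment (f := F) (df := fun=> 0) ab.
    by have [//|dFx <-] := dF x xab; rewrite derive1E; exact: derivableP.
  by rewrite mul0r => /eqP; rewrite subr_eq0 => /eqP.
have [sab|sab] := boolP (s \in `]a, b[); last first.
  apply: IH => // x xab xS; apply: dF => //.
  by rewrite inE negb_or xS andbT; apply: contraNneq sab => <-.
have [as_ sb] : a <= s /\ s <= b.
  by move: sab; rewrite in_itv /= => /andP[/ltW ? /ltW ?].
transitivity (F s); apply: IH => //.
- apply: continuous_subspaceW cF; apply: subset_itvr; by rewrite bnd_simp.
- move=> x; rewrite in_itv /= => /andP[sx xb] xS; apply: dF.
    by rewrite in_itv /= xb andbT (le_lt_trans as_).
  by rewrite inE negb_or xS andbT gt_eqF.
- apply: continuous_subspaceW cF; apply: subset_itvl; by rewrite bnd_simp.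
- move=> x; rewrite in_itv /= => /andP[sx xb] xS; apply: dF.
    by rewrite in_itv /= sx /= (lt_le_trans xb).
  by rewrite inE negb_or xS andbT lt_eqF.
Qed.

Lemma is_derive_derive1 F x : derivable F x 1 -> is_derive x 1 F (F^`()%classic x).
Proof. by move=> dF; rewrite derive1E; exact: derivableP. Qed.

(* The exceptional set S absorbs the break points of a piecewise C^1 curve, whose
   real and imaginary parts need not share a partition; S = [::] gives the
   improper version, with f only continuous inside the interval. *)
Lemma FTC2_off_seq S F f a b : a <= b ->
  {within `[a, b], continuous F} ->
  mu.-integrable `[a, b] (EFin \o f) ->
  (forall x, x \in `]a, b[ -> x \notin S ->
     {for x, continuous f} /\ is_derive x 1 F (f x)) ->
  \int[mu]_(x in `[a, b]) f x = F b - F a.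
Proof.
move=> ab cF intf dF.
pose H x := \int[mu]_(t in `[a, x]) f t.
have Ha : H a = 0 by rewrite /H set_itv1 Rintegral_set1.
have cH : {within `[a, b], continuous H}.
  exact: parameterized_integral_continuous.
(* The integral function [H] has derivative [f] off [S], so [H - F] is continuous with zero
   derivative off [S]. *)
suff : (H - F) b = (H - F) a.
  by rewrite /= !fctE Ha -/(H b) => h; lra.
apply: (@eq_of_derive0_off_seq S) => //.
  by move=> x; apply: cvgB; [exact: cH|exact: cF].
move=> x xab xS; have [cf dFx] := dF _ xab xS.
move: (xab); rewrite in_itv /= => /andP[ax xb].
have [dH H'] := @continuous_FTC1_closed R f a x b xb intf ax cf.
have {dFx} [dFx F'] := dFx; split; first exact: derivableB.
by rewrite derive1E deriveB // F' -derive1E H' subrr.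
Qed.

End FTC.

(** * Piecewise C^1 functions *)

Section PiecewiseC1.
Variable R : realType.
Implicit Types (f g h : R -> R) (a b c x v : R).
Local Notation mu := (@lebesgue_measure R).

Lemma itvcc_setU a b c : a <= b -> b <= c -> `[a, c]%classic = `[a, b] `|` `[b, c].
Proof.
move=> ab bc; apply/seteqP; split=> x /=; rewrite !in_itv /=.
  by move=> /andP[-> ->]; case: (leP x b) => [xb|/ltW bx]; [left|right];
    rewrite ?xb ?bx.
by case=> /andP[h1 h2]; rewrite ?h1 ?h2 ?(le_trans ab) ?(le_trans h2).
Qed.

Lemma itvcc_setUoc a b c : a <= b -> b <= c -> `[a, c]%classic = `[a, b] `|` `]b, c].
Proof.
move=> ab bc; apply/seteqP; split=> x /=; rewrite !in_itv /=.
  by move=> /andP[-> ->]; case: (leP x b) => [xb|bx]; [left|right].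
case=> /andP[h1 h2]; rewrite ?h1 ?h2 /=; first exact: (le_trans h2).
by rewrite (le_trans ab) ?ltW.
Qed.

Lemma disj_itvcc_oc a b c : [disjoint `[a, b]%classic & `]b, c]%classic].
Proof.
apply/disj_setPS => x [] /=; rewrite !in_itv /= => /andP[_ xb] /andP[bx _].
by move: (lt_le_trans bx xb); rewrite ltxx.
Qed.

Lemma integrable_itvU f a b c : a <= b -> b <= c ->
  mu.-integrable `[a, b] (EFin \o f) -> mu.-integrable `[b, c] (EFin \o f) ->
  mu.-integrable `[a, c] (EFin \o f).
Proof.
move=> ab bc /integrableP[mf1 if1] /integrableP[mf2 if2].
have mf : measurable_fun `[a, c] (fun x : R => (f x)%:E).
  by rewrite (itvcc_setU ab bc); apply/measurable_funU.
apply/integrableP; split => //.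
rewrite (itvcc_setUoc ab bc) ge0_integral_setU //; last 2 first.
- rewrite -(itvcc_setUoc ab bc). exact: measurableT_comp.
- exact: disj_itvcc_oc.
apply: lte_add_pinfty => //; apply: le_lt_trans if2.
apply: ge0_subset_integral => //.
- exact: measurableT_comp.
- by apply: subset_itvr; rewrite bnd_simp.
Qed.

(** Two points are negligible, so the values of [f] at the ends do not matter: they are uncontrolled
    for the derivative of a C^1 piece and conventional for a weight singular at 1. *)
Lemma integrable_itv_cc f a b : a < b ->
  mu.-integrable `]a, b[ (EFin \o f) -> mu.-integrable `[a, b] (EFin \o f).
Proof.
move=> ab if_; have /integrableP[mf _] := if_.
have mf' : measurable_fun `[a, b] (fun x : R => (f x)%:E) by apply: emeasurable_fun_itv_cc mf.
apply/(@negligible_integrable _ _ _ mu _ ([set a] `|` [set b])) => //.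
- by apply: measurableU; exact: measurable_set1.
- by rewrite measureU0 //; exact: lebesgue_measure_set1.
- apply: integrableS if_ => //.
    by apply: measurableD => //; apply: measurableU; exact: measurable_set1.
  move=> x [] /=; rewrite !in_itv /= => /andP[ax xb] /not_orP[xa xb'].
  by rewrite !lt_neqAle ax xb !andbT eq_sym; apply/andP; split; apply/eqP.
Qed.

(** Inside the interval the derivative coincides with its continuous extension [g], which is
    integrable by compactness. *)
Lemma C1_on_deriv f a b : a < b -> C1_on f a b ->
  [/\ {within `[a, b], continuous f},
      mu.-integrable `[a, b] (EFin \o f^`()%classic) &
      forall v, v \in `]a, b[ ->
        derivable f v 1 /\ {for v, continuous f^`()%classic}].
Proof.
move=> ab [df [g cg fg]]; split.
- exact: derivable_oo_LRcontinuous_within.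
- apply: integrable_itv_cc => //.
  have ig : mu.-integrable `[a, b] (EFin \o g).
    by apply: continuous_compact_integrable => //; exact: segment_compact.
  have ig' : mu.-integrable `]a, b[ (EFin \o g).
    by apply: integrableS ig => //; exact: subset_itv_oo_cc.
  by apply: eq_integrable ig' => // x; rewrite inE /= => xab; rewrite /= fg.
- move=> v vab; split; first by case: df => + _ _; exact.
  have cgv := within_continuous_continuous ab cg vab.
  rewrite /prop_for /continuous_at fg //; apply: cvg_trans cgv.
  apply: near_eq_cvg; near=> x; rewrite fg //.
  by near: x; exact: near_in_itvoo.
Unshelve. all: by end_near. Qed.

(** Starting at an arbitrary [a] lets the induction strip the first piece; the inner break points
    form [S]. *)
Lemma path_C1_deriv f (ts : seq R) a : path <%R a ts ->
  (forall i, (i < size ts)%N ->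
     C1_on f (nth 0 (a :: ts) i) (nth 0 (a :: ts) i.+1)) ->
  [/\ a <= last a ts,
      {within `[a, last a ts], continuous f},
      mu.-integrable `[a, last a ts] (EFin \o f^`()%classic) &
      exists S : seq R, forall v, v \in `]a, last a ts[ -> v \notin S ->
        derivable f v 1 /\ {for v, continuous f^`()%classic}].
Proof.
elim: ts a => [a _ _|b ts IH a /= /andP[ab pts] H] /=.
  rewrite set_itv1; split=> //; first exact: continuous_subspace1.
  - apply: null_set_integrable => //; first exact: measurable_fun_set1.
    exact: lebesgue_measure_set1.
  - by exists nil => v; rewrite in_itv /= lt_asym.
have [ble cf idf [S HS]] := IH b pts (fun i (h : (i < size ts)%N) => H i.+1 h).
have [cf1 idf1 HS1] := C1_on_deriv ab (H 0%N isT).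
have ab' := ltW ab; split.
- exact: le_trans ble.
- by rewrite (itvcc_setU ab' ble); apply: withinU_continuous => //; exact: itv_closed.
- exact: integrable_itvU idf.
- exists (b :: S) => v; rewrite !in_itv /= inE negb_or => /andP[av vl] /andP[vb vS].
  case: (ltgtP v b) vb => // vb _; first by apply: HS1; rewrite in_itv /= av.
  by apply: HS => //; rewrite in_itv /= vb.
Qed.

Lemma piecewise_C1_deriv f : piecewise_C1 f ->
  [/\ {within `[0, 1], continuous f},
      mu.-integrable `[0, 1] (EFin \o f^`()%classic) &
      exists S : seq R, forall v, v \in `]0, 1[ -> v \notin S ->
        derivable f v 1 /\ {for v, continuous f^`()%classic}].
Proof.
by move=> [ts [pts lts H]]; have := path_C1_deriv pts H; rewrite lts => -[].
Qed.

End PiecewiseC1.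

(** * Complex-valued integrals along curves *)

Section ComplexValued.
Variable R : realType.
Local Notation Re := (@complex.Re R).
Local Notation Im := (@complex.Im R).
Local Notation mu := (@lebesgue_measure R).
Implicit Types (D : set (measurableTypeR R)) (z w k : R[i]) (F G : R -> R[i]) (v a b : R).

Lemma cReD z w : Re (z + w) = Re z + Re w. Proof. by case: z; case: w. Qed.
Lemma cImD z w : Im (z + w) = Im z + Im w. Proof. by case: z; case: w. Qed.
Lemma cReN z : Re (- z) = - Re z. Proof. by case: z. Qed.
Lemma cImN z : Im (- z) = - Im z. Proof. by case: z. Qed.
Lemma cReM z w : Re (z * w) = Re z * Re w - Im z * Im w.
Proof. by case: z; case: w. Qed.
Lemma cImM z w : Im (z * w) = Re z * Im w + Im z * Re w.
Proof. by case: z; case: w. Qed.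
Lemma cReV z : Re z^-1 = Re z / (Re z ^+ 2 + Im z ^+ 2).
Proof. by case: z. Qed.
Lemma cImV z : Im z^-1 = - (Im z / (Re z ^+ 2 + Im z ^+ 2)).
Proof. by case: z. Qed.

Lemma complex_ext z w : Re z = Re w -> Im z = Im w -> z = w.
Proof. by case: z; case: w => /= ? ? ? ? -> ->. Qed.

Lemma sqr_ReIm_neq0 z : z != 0 -> Re z ^+ 2 + Im z ^+ 2 != 0.
Proof.
apply: contraNneq => /eqP; rewrite paddr_eq0 ?sqr_ge0 // !sqrf_eq0.
by case: z => x y /= /andP[/eqP-> /eqP->].
Qed.

Definition cintegrable (D : set (measurableTypeR R)) F :=
  mu.-integrable D (EFin \o (Re \o F)) /\ mu.-integrable D (EFin \o (Im \o F)).

Lemma cintegrableD D F G : measurable D ->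
  cintegrable D F -> cintegrable D G -> cintegrable D (fun v => F v + G v).
Proof.
move=> mD [F1 F2] [G1 G2]; split.
- have := integrableD mD F1 G1; apply: eq_integrable => // v _ /=.
  by rewrite cReD EFinD.
- have := integrableD mD F2 G2; apply: eq_integrable => // v _ /=.
  by rewrite cImD EFinD.
Qed.

Lemma cintegralD D F G : measurable D ->
  cintegrable D F -> cintegrable D G ->
  cintegral D (fun v => F v + G v) = cintegral D F + cintegral D G.
Proof.
move=> mD [F1 F2] [G1 G2]; rewrite /cintegral; apply: complex_ext.
  rewrite cReD /= -RintegralD //; by apply: eq_Rintegral => v _; rewrite cReD.
rewrite cImD /= -RintegralD //; by apply: eq_Rintegral => v _; rewrite cImD.
Qed.

Lemma integrable_lincomb D (f g : R -> R) (c d : R) : measurable D ->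
  mu.-integrable D (EFin \o f) -> mu.-integrable D (EFin \o g) ->
  mu.-integrable D (EFin \o (fun v => c * f v + d * g v)).
Proof.
move=> mD fi gi.
have := integrableD mD (integrableZl mD c fi) (integrableZl mD d gi).
by apply: eq_integrable => // v _ /=; rewrite EFinD !EFinM.
Qed.

Lemma Rintegral_lincomb D (f g : R -> R) (c d : R) : measurable D ->
  mu.-integrable D (EFin \o f) -> mu.-integrable D (EFin \o g) ->
  \int[mu]_(v in D) (c * f v + d * g v) =
  c * \int[mu]_(v in D) f v + d * \int[mu]_(v in D) g v.
Proof.
move=> mD fi gi; rewrite RintegralD //=.
- by rewrite !RintegralZl.
- have := integrableZl mD c fi; apply: eq_integrable => // v _ /=.
- have := integrableZl mD d gi; apply: eq_integrable => // v _ /=.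
Qed.

Lemma cintegrableZ D k F : measurable D ->
  cintegrable D F -> cintegrable D (fun v => k * F v).
Proof.
move=> mD [F1 F2]; split.
- have := integrable_lincomb (Re k) (- Im k) mD F1 F2.
  by apply: eq_integrable => // v _ /=; rewrite cReM mulNr.
- have := integrable_lincomb (Re k) (Im k) mD F2 F1.
  by apply: eq_integrable => // v _ /=; rewrite cImM.
Qed.

Lemma cintegralZ D k F : measurable D ->
  cintegrable D F -> cintegral D (fun v => k * F v) = k * cintegral D F.
Proof.
move=> mD [F1 F2]; rewrite /cintegral; apply: complex_ext.
  rewrite cReM /= -mulNr -Rintegral_lincomb //.
  by apply: eq_Rintegral => v _; rewrite cReM mulNr.
rewrite cImM /= -Rintegral_lincomb //.
by apply: eq_Rintegral => v _; rewrite cImM.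
Qed.

Lemma eq_cintegral D F G : {in D, F =1 G} -> cintegral D F = cintegral D G.
Proof.
move=> FG; rewrite /cintegral; congr (_ +i* _);
  by apply: eq_Rintegral => v vD; rewrite FG.
Qed.

Lemma cintegral_sum D (n : nat) (F : nat -> R -> R[i]) : measurable D ->
  (forall i, (i < n)%N -> cintegrable D (F i)) ->
  cintegrable D (fun v => \sum_(i < n) F i v) /\
  cintegral D (fun v => \sum_(i < n) F i v) = \sum_(i < n) cintegral D (F i).
Proof.
move=> mD; elim: n => [_|n IH H].
  have E0 : (fun v : R => \sum_(i < 0) F i v) = fun=> 0.
    by apply/funext => v; rewrite big_ord0.
  rewrite E0 big_ord0; split; first by split; exact: integrable0.
  have cst0 : \int[mu]_(v in D) (0 : R) = 0 by rewrite Rintegral_cst // mul0r.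
  by rewrite /cintegral /= cst0.
have [IH1 IH2] := IH (fun i h => H i (ltnW h)).
have E : (fun v : R => \sum_(i < n.+1) F i v) =
         fun v => \sum_(i < n) F i v + F n v.
  by apply/funext => v; rewrite big_ord_recr.
rewrite E; split; first exact: cintegrableD IH1 (H n _).
by rewrite cintegralD ?IH2 ?big_ord_recr //; exact: H.
Qed.

(** Continuity is asked only within the parameter interval, as nothing is known of a curve outside
    [0, 1]. *)
Definition ccontinuous F :=
  {within `[0, 1], continuous (Re \o F)} /\
  {within `[0, 1], continuous (Im \o F)}.

Lemma ccontinuous_ext F G : F =1 G -> ccontinuous F -> ccontinuous G.
Proof. by move=> /funext ->. Qed.

Lemma ccontinuous_cst z : ccontinuous (fun=> z).
Proof. by split=> v; exact: cvg_cst. Qed.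

Lemma ccontinuousD F G : ccontinuous F -> ccontinuous G ->
  ccontinuous (fun v => F v + G v).
Proof.
move=> [F1 F2] [G1 G2]; split.
- have -> : Re \o (fun v => F v + G v) = (Re \o F) \+ (Re \o G).
    by apply/funext => v /=; rewrite cReD.
  by move=> v; apply: cvgD; [exact: F1|exact: G1].
- have -> : Im \o (fun v => F v + G v) = (Im \o F) \+ (Im \o G).
    by apply/funext => v /=; rewrite cImD.
  by move=> v; apply: cvgD; [exact: F2|exact: G2].
Qed.

Lemma ccontinuousM F G : ccontinuous F -> ccontinuous G ->
  ccontinuous (fun v => F v * G v).
Proof.
move=> [F1 F2] [G1 G2]; split.
- have -> : Re \o (fun v => F v * G v) =
     fun v => (Re \o F) v * (Re \o G) v - (Im \o F) v * (Im \o G) v.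
    by apply/funext => v /=; rewrite cReM.
  by move=> v; apply: cvgB; apply: cvgM;
    [exact: F1|exact: G1|exact: F2|exact: G2].
- have -> : Im \o (fun v => F v * G v) =
     fun v => (Re \o F) v * (Im \o G) v + (Im \o F) v * (Re \o G) v.
    by apply/funext => v /=; rewrite cImM.
  by move=> v; apply: cvgD; apply: cvgM;
    [exact: F1|exact: G2|exact: F2|exact: G1].
Qed.

Lemma ccontinuousX F n : ccontinuous F -> ccontinuous (fun v => F v ^+ n).
Proof.
move=> cF; elim: n => [|n IH]; first exact: ccontinuous_cst.
have -> : (fun v => F v ^+ n.+1) = (fun v => F v * F v ^+ n).
  by apply/funext => v; rewrite exprS.
exact: ccontinuousM.
Qed.

Lemma ccontinuousV F : (forall v, 0 <= v <= 1 -> F v != 0) ->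
  ccontinuous F -> ccontinuous (fun v => (F v)^-1).
Proof.
move=> F0 [F1 F2].
(* The squared modulus, the common denominator of both parts of the inverse. *)
pose N v := (Re \o F) v * (Re \o F) v + (Im \o F) v * (Im \o F) v.
have cN : {within `[0, 1], continuous N}.
  by move=> v; apply: cvgD; apply: cvgM; [exact: F1|exact: F1|exact: F2|exact: F2].
have cNV : {within `[0, 1], continuous (fun v => (N v)^-1)}.
  apply/subspace_continuousP => v v01.
  apply: cvgV; last by move/subspace_continuousP : cN; exact.
  by rewrite /N -!expr2; apply: sqr_ReIm_neq0; apply: F0; move: v01; rewrite /= in_itv.
split.
- have -> : Re \o (fun v => (F v)^-1) = fun v => (Re \o F) v * (N v)^-1.
    by apply/funext => v /=; rewrite cReV /N !expr2.
  by move=> v; apply: cvgM; [exact: F1|exact: cNV].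
- have -> : Im \o (fun v => (F v)^-1) = fun v => - ((Im \o F) v * (N v)^-1).
    by apply/funext => v /=; rewrite cImV /N !expr2.
  by move=> v; apply: cvgN; apply: cvgM; [exact: F2|exact: cNV].
Qed.

(** A componentwise derivative in the real parameter, matching [curve_deriv]. With its product and
    inverse rules, functions composed with a curve are differentiated directly, without complex
    differentiability. *)
Definition cderive F v z :=
  is_derive v 1 (Re \o F) (Re z) /\ is_derive v 1 (Im \o F) (Im z).

Lemma cderive_cst k v : cderive (fun=> k) v 0.
Proof.
by split; [have := is_derive_cst (Re k) v (1:R)|have := is_derive_cst (Im k) v (1:R)].
Qed.

Lemma cderiveD F G v z w : cderive F v z -> cderive G v w ->
  cderive (fun v => F v + G v) v (z + w).
Proof.
move=> [F1 F2] [G1 G2]; split.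
- have -> : Re \o (fun v => F v + G v) = (Re \o F) + (Re \o G).
    by apply/funext => u /=; rewrite cReD.
  by apply: is_derive_eq; rewrite cReD.
- have -> : Im \o (fun v => F v + G v) = (Im \o F) + (Im \o G).
    by apply/funext => u /=; rewrite cImD.
  by apply: is_derive_eq; rewrite cImD.
Qed.

Lemma cderiveM F G v z w : cderive F v z -> cderive G v w ->
  cderive (fun v => F v * G v) v (z * G v + F v * w).
Proof.
move=> [F1 F2] [G1 G2]; split.
- have -> : Re \o (fun v => F v * G v) =
     (Re \o F) * (Re \o G) - (Im \o F) * (Im \o G).
    by apply/funext => u /=; rewrite cReM.
  apply: (is_derive_eq (is_deriveB (is_deriveM F1 G1) (is_deriveM F2 G2))).
  rewrite !(cReD, cReM) /= /GRing.scale /=; ring.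
- have -> : Im \o (fun v => F v * G v) =
     (Re \o F) * (Im \o G) + (Im \o F) * (Re \o G).
    by apply/funext => u /=; rewrite cImM.
  apply: (is_derive_eq (is_deriveD (is_deriveM F1 G2) (is_deriveM F2 G1))).
  rewrite !(cImD, cImM) /= /GRing.scale /=; ring.
Qed.

Lemma cderiveX F n v z : cderive F v z ->
  cderive (fun v => F v ^+ n.+1) v (n.+1%:R * F v ^+ n * z).
Proof.
move=> dF; elim: n => [|n IH].
  by rewrite expr0 mulr1 mul1r.
have -> : (fun v => F v ^+ n.+2) = (fun v => F v * F v ^+ n.+1).
  by apply/funext => u; rewrite exprS.
have := cderiveM dF IH; congr (cderive _ _ _).
rewrite exprS [n.+2%:R]mulrSr; ring.
Qed.

Lemma cderiveV F v z : F v != 0 -> cderive F v z ->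
  cderive (fun v => (F v)^-1) v (- (F v) ^- 2 * z).
Proof.
move=> F0 [F1 F2]; have N0 := sqr_ReIm_neq0 F0.
pose N := (Re \o F) * (Re \o F) + (Im \o F) * (Im \o F).
have dN : is_derive v 1 N (2 * (Re (F v) * Re z + Im (F v) * Im z)).
  apply: (is_derive_eq (is_deriveD (is_deriveM F1 F1) (is_deriveM F2 F2)));
    rewrite /= /GRing.scale /=; ring.
have NE u : N u = Re (F u) ^+ 2 + Im (F u) ^+ 2 by rewrite !expr2.
have N0' : N v != 0 by rewrite NE.
have E : - F v ^- 2 * z = - ((F v)^-1 * (F v)^-1 * z).
  by rewrite -exprVn expr2 mulNr.
have dNV := is_deriveV N0' dN.
split.
- have -> : Re \o (fun v => (F v)^-1) = (Re \o F) * (fun v => (N v)^-1).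
    by apply/funext => u /=; rewrite cReV -NE.
  apply: (is_derive_eq (is_deriveM F1 dNV)); rewrite E cReN !(cReM, cImM) !cReV !cImV.
  rewrite /= /GRing.scale /= NE; by field.
- have -> : Im \o (fun v => (F v)^-1) = - ((Im \o F) * (fun v => (N v)^-1)).
    by apply/funext => u /=; rewrite cImV -NE.
  apply: (is_derive_eq (is_deriveN (is_deriveM F2 dNV))); rewrite E cImN !(cReM, cImM) !cReV !cImV.
  rewrite /= /GRing.scale /= NE; by field.
Qed.

End ComplexValued.

(** * Integrals of powers and simple fractions along the contour *)

Section Contour.
Variables (R : realType) (gamma : R -> R[i]).
Hypothesis hgamma : encircling_contour gamma.
Local Notation Re := (@complex.Re R).
Local Notation Im := (@complex.Im R).
Local Notation mu := (@lebesgue_measure R).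
Local Notation oint := (contour_integral gamma).
Implicit Types (f F : R[i] -> R[i]) (x v : R) (u k : R[i]).

Let contP f := ccontinuous (f \o gamma).

Lemma contour_continuous : ccontinuous gamma.
Proof.
by have [/piecewise_C1_deriv[? _ _] /piecewise_C1_deriv[? _ _] _ _ _] := hgamma.
Qed.

(** A factor continuous on a compact interval is bounded, and [curve_deriv] has integrable
    components; the complex product expands into four real ones. *)
Lemma contour_integrable f : contP f ->
  cintegrable `[0, 1] (fun v => f (gamma v) * curve_deriv gamma v).
Proof.
have [/piecewise_C1_deriv[_ i1 _] /piecewise_C1_deriv[_ i2 _] _ _ _] := hgamma.
move=> [f1 f2].
have bnd (h : R -> R) : {within `[0, 1], continuous h} ->
    measurable_fun (`[0, 1]%classic : set (measurableTypeR R)) h /\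
    [bounded h v | v in (`[0, 1]%classic : set R)].
  move=> ch; split; first exact: subspace_continuous_measurable_fun.
  have c01 := @segment_compact R 0 1.
  have /compact_bounded[M [_ mrt]] := continuous_compact ch c01.
  by exists M; split; rewrite ?num_real // => ? ? ? ?; exact: mrt.
have [m1 b1] := bnd _ f1; have [m2 b2] := bnd _ f2.
have m01 : measurable (`[0, 1]%classic : set (measurableTypeR R)) by [].
split.
- have := integrableB m01 (integrableMr m01 m1 b1 i1) (integrableMr m01 m2 b2 i2).
  by apply: eq_integrable => // v _ /=; rewrite cReM.
- have := integrableD m01 (integrableMr m01 m1 b1 i2) (integrableMr m01 m2 b2 i1).
  by apply: eq_integrable => // v _ /=; rewrite cImM.
Qed.

(** The integral is the increment of [F] along a closed curve. The assumption on [F] is just the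
    chain rule along [gamma]. *)
Lemma contour_integral_primitive F f : contP F -> contP f ->
  (forall v w, 0 <= v <= 1 -> cderive gamma v w ->
     cderive (F \o gamma) v (f (gamma v) * w)) ->
  oint f = 0.
Proof.
move=> [F1 F2] cf dF; have [f1 f2] := cf.
have [i1 i2] := contour_integrable cf.
have [/piecewise_C1_deriv[_ _ [S1 HS1]] /piecewise_C1_deriv[_ _ [S2 HS2]] g01 _ _]
  := hgamma.
have P v : v \in `]0, 1[ -> v \notin S1 ++ S2 ->
  [/\ cderive (F \o gamma) v (f (gamma v) * curve_deriv gamma v),
      {for v, continuous (Re \o curve_deriv gamma)},
      {for v, continuous (Im \o curve_deriv gamma)},
      {for v, continuous (Re \o (f \o gamma))} &
      {for v, continuous (Im \o (f \o gamma))}].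
  move=> v01; rewrite mem_cat negb_or => /andP[vS1 vS2].
  have [d1 c1] := HS1 v v01 vS1; have [d2 c2] := HS2 v v01 vS2.
  split; [|exact: c1|exact: c2| |].
  - apply: dF; first by move: v01; rewrite in_itv /= => /andP[/ltW -> /ltW ->].
    exact: (conj (is_derive_derive1 d1) (is_derive_derive1 d2)).
  - exact: within_continuous_continuous f1 v01.
  - exact: within_continuous_continuous f2 v01.
rewrite /contour_integral /cintegral; apply: complex_ext => /=.
- rewrite (@FTC2_off_seq R (S1 ++ S2) (Re \o (F \o gamma))) //=.
    by rewrite g01 subrr.
  move=> v v01 vS; have [[dR _] cR cI fR fI] := P v v01 vS; split; [|exact: dR].
  have -> : (fun v => Re (f (gamma v) * curve_deriv gamma v)) =
    fun v => (Re \o (f \o gamma)) v * (Re \o curve_deriv gamma) v -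
             (Im \o (f \o gamma)) v * (Im \o curve_deriv gamma) v.
    by apply/funext => w; rewrite cReM.
  by apply: cvgB; apply: cvgM; [exact: fR|exact: cR|exact: fI|exact: cI].
- rewrite (@FTC2_off_seq R (S1 ++ S2) (Im \o (F \o gamma))) //=.
    by rewrite g01 subrr.
  move=> v v01 vS; have [[_ dI] cR cI fR fI] := P v v01 vS; split; [|exact: dI].
  have -> : (fun v => Im (f (gamma v) * curve_deriv gamma v)) =
    fun v => (Re \o (f \o gamma)) v * (Im \o curve_deriv gamma) v +
             (Im \o (f \o gamma)) v * (Re \o curve_deriv gamma) v.
    by apply/funext => w; rewrite cImM.
  by apply: cvgD; apply: cvgM; [exact: fR|exact: cI|exact: fI|exact: cR].
Qed.

Lemma contour_integralD f g : contP f -> contP g ->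
  oint (fun u => f u + g u) = oint f + oint g.
Proof.
move=> cf cg; rewrite /contour_integral -cintegralD //; last 2 first.
- exact: contour_integrable.
- exact: contour_integrable.
by apply: eq_cintegral => v _; rewrite mulrDl.
Qed.

Lemma contour_integralZ k f : contP f -> oint (fun u => k * f u) = k * oint f.
Proof.
move=> cf; rewrite /contour_integral -cintegralZ //; last exact: contour_integrable.
by apply: eq_cintegral => v _; rewrite mulrA.
Qed.

Lemma eq_contour_integral f g :
  (forall v, 0 <= v <= 1 -> f (gamma v) = g (gamma v)) -> oint f = oint g.
Proof.
move=> fg; apply: eq_cintegral => v; rewrite inE /= in_itv /= => v01.
by rewrite fg.
Qed.

Lemma contour_integral_sum (n : nat) (c : nat -> R[i]) (f : nat -> R[i] -> R[i]) :
  (forall i, contP (f i)) ->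
  oint (fun u => \sum_(i < n) c i * f i u) = \sum_(i < n) c i * oint (f i).
Proof.
move=> cf.
have ci i : (i < n)%N ->
    cintegrable `[0, 1] (fun v => c i * (f i (gamma v) * curve_deriv gamma v)).
  by move=> _; apply: cintegrableZ => //; exact: contour_integrable.
have m01 : measurable (`[0, 1]%classic : set (measurableTypeR R)) by [].
have [_ E] := cintegral_sum m01 ci.
rewrite /contour_integral; transitivity (cintegral `[0, 1] (fun v =>
    \sum_(i < n) c i * (f i (gamma v) * curve_deriv gamma v))).
  by apply: eq_cintegral => v _; rewrite mulr_suml; apply: eq_bigr => i _;
    rewrite mulrA.
rewrite E; apply: eq_bigr => i _; rewrite cintegralZ //.
exact: contour_integrable.
Qed.

Lemma contour_neq x v : -1 <= x <= 1 -> 0 <= v <= 1 -> x%:C - gamma v != 0.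
Proof.
move=> x1 v01; have [_ _ _ _ /(_ x x1)[+ _]] := hgamma.
by move=> /(_ v v01); rewrite subr_eq0 eq_sym.
Qed.

Lemma contour_neq1 v : 0 <= v <= 1 -> 1 - gamma v != 0.
Proof. by apply: (@contour_neq 1); lra. Qed.

Lemma contP_sub k : contP (fun u => k - u).
Proof.
have := ccontinuousD (ccontinuous_cst k)
  (ccontinuousM (ccontinuous_cst (-1)) contour_continuous).
by apply: ccontinuous_ext => v; rewrite /= mulN1r.
Qed.

Lemma contP_subX n : contP (fun u => (1 - u) ^+ n).
Proof. exact: (ccontinuousX n (contP_sub 1)). Qed.

Lemma contP_subV x : -1 <= x <= 1 -> contP (fun u => (x%:C - u)^-1).
Proof.
move=> x1; apply: (ccontinuousV _ (contP_sub x%:C)) => v; exact: contour_neq.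
Qed.

Lemma contP_subXV n : contP (fun u => (1 - u)^-1 ^+ n).
Proof.
by apply: (ccontinuousX n); apply: (@contP_subV 1); lra.
Qed.

Lemma cderive_sub k v w : cderive gamma v w ->
  cderive (fun v => k - gamma v) v (- w).
Proof.
move=> dg; have := cderiveD (cderive_cst k v)
  (cderiveM (cderive_cst (-1) v) dg).
rewrite mul0r !add0r mulN1r.
by have -> : (fun v => k + -1 * gamma v) = (fun v => k - gamma v)
  by apply/funext => ?; rewrite mulN1r.
Qed.

Lemma contour_integral_subX n : oint (fun u => (1 - u) ^+ n) = 0.
Proof.
pose c : R[i] := - (n.+1%:R)^-1.
apply: (@contour_integral_primitive (fun u => c * (1 - u) ^+ n.+1)).
- exact: (ccontinuousM (ccontinuous_cst c) (contP_subX n.+1)).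
- exact: contP_subX.
- move=> v w _ dg.
  have := cderiveM (cderive_cst c v) (cderiveX n (cderive_sub 1 dg)).
  rewrite mul0r add0r; congr (cderive _ _ _).
  rewrite /c mulrA mulrA mulNr mulVf ?pnatr_eq0 //; ring.
Qed.

(** The exponent starts at 2, where a primitive exists; exponent 1 yields the winding number about
    1. *)
Lemma contour_integral_subXV n : oint (fun u => (1 - u)^-1 ^+ n.+2) = 0.
Proof.
pose c : R[i] := (n.+1%:R)^-1.
apply: (@contour_integral_primitive (fun u => c * (1 - u)^-1 ^+ n.+1)).
- exact: (ccontinuousM (ccontinuous_cst c) (contP_subXV n.+1)).
- exact: contP_subXV.
- move=> v w v01 dg.
  have := cderiveM (cderive_cst c v)
    (cderiveX n (cderiveV (contour_neq1 v01) (cderive_sub 1 dg))).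
  rewrite mul0r add0r; congr (cderive _ _ _).
  rewrite /c !mulrA mulVf ?pnatr_eq0 // !exprS expr0 mulr1 mul1r invfM; ring.
Qed.

Lemma two_pi_i_neq0 : two_pi_i R != 0.
Proof.
rewrite /two_pi_i !mulf_neq0 ?pnatr_eq0 //.
  by rewrite eq_complex /= negb_and gt_eqF ?pi_gt0.
by rewrite eq_complex /= oner_eq0 andbF.
Qed.

(** The minus sign comes from the order x - u, opposite to that in [winding_number]. *)
Lemma contour_integral_subV x : -1 <= x <= 1 ->
  oint (fun u => (x%:C - u)^-1) = - two_pi_i R.
Proof.
move=> x1; have [_ _ _ _ /(_ x x1)[_ +]] := hgamma; rewrite /winding_number => W.
transitivity (oint (fun u => (-1) * (u - x%:C)^-1)).
  by apply: eq_contour_integral => v _; rewrite mulN1r -invrN opprB.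
rewrite contour_integralZ; last first.
  have := ccontinuousM (ccontinuous_cst (-1)) (contP_subV x1).
  by apply: ccontinuous_ext => v; rewrite /= mulN1r -invrN opprB.
by rewrite mulN1r -[X in _ = - X]mulr1 -W mulrA divff ?two_pi_i_neq0 // mul1r.
Qed.

(** Writing one factor 1 - u as (1 - x) + (x - u) lowers the power and leaves a polynomial, whose
    integral vanishes. *)
Lemma contour_integral_subX_subV n x : -1 <= x <= 1 ->
  oint (fun u => (1 - u) ^+ n * (x%:C - u)^-1) =
  - two_pi_i R * ((1 - x) ^+ n)%:C.
Proof.
move=> x1; have cX m := ccontinuousM (contP_subX m) (contP_subV x1).
elim: n => [|n IH].
  rewrite expr0 mulr1 -(contour_integral_subV x1).
  by apply: eq_contour_integral => v _; rewrite expr0 mul1r.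
transitivity (oint (fun u => (1 - x)%:C * ((1 - u) ^+ n * (x%:C - u)^-1)
                            + (1 - u) ^+ n)).
  apply: eq_contour_integral => v v01; have B0 := contour_neq x1 v01.
  rewrite exprS rmorphB rmorph1; field; exact: B0.
rewrite contour_integralD; last 2 first.
- exact: (ccontinuousM (ccontinuous_cst _) (cX n)).
- exact: contP_subX.
rewrite contour_integralZ; last exact: cX.
rewrite IH contour_integral_subX addr0 exprS rmorphM /=; ring.
Qed.

(* With A = 1 - u and B = x - u, (1 - x) / (A B) = 1 / B - 1 / A lowers the power
   of 1 / A; the two winding numbers cancel at the last step. *)
Lemma contour_integral_subXV_subV n x : -1 <= x < 1 ->
  oint (fun u => (1 - u)^-1 ^+ n.+1 * (x%:C - u)^-1) = 0.
Proof.
move=> /andP[x1 x1']; have xx : -1 <= x <= 1 by rewrite x1 ltW.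
have y0 : (1 - x)%:C != 0 by rewrite eq_complex /= eqxx andbT subr_eq0 gt_eqF.
have cX m := ccontinuousM (contP_subXV m) (contP_subV xx).
have rec m : (1 - x)%:C * oint (fun u => (1 - u)^-1 ^+ m.+1 * (x%:C - u)^-1) =
    oint (fun u => (1 - u)^-1 ^+ m * (x%:C - u)^-1)
    - oint (fun u => (1 - u)^-1 ^+ m.+1).
  rewrite -contour_integralZ; last exact: cX.
  rewrite -[- oint _]mulN1r -contour_integralZ; last exact: contP_subXV.
  rewrite -contour_integralD; last 2 first.
  - exact: cX.
  - exact: (ccontinuousM (ccontinuous_cst _) (contP_subXV _)).
  apply: eq_contour_integral => v v01; have B0 := contour_neq xx v01.
  have A0 := contour_neq1 v01.
  rewrite exprS rmorphB rmorph1; field; do ?[apply/andP; split] => //.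
apply: (mulfI y0); rewrite mulr0; elim: n => [|n IH].
  rewrite rec.
  have -> : oint (fun u => (1 - u)^-1 ^+ 0 * (x%:C - u)^-1) = - two_pi_i R.
    rewrite -(contour_integral_subV xx).
    by apply: eq_contour_integral => v _; rewrite expr0 mul1r.
  have -> : oint (fun u => (1 - u)^-1 ^+ 1) = - two_pi_i R.
    by apply: (@contour_integral_subV 1); lra.
  by rewrite subrr.
rewrite rec contour_integral_subXV subr0; apply: (mulfI y0).
by rewrite IH mulr0.
Qed.

Lemma contour_integral_monomial (i r : nat) x : -1 <= x < 1 ->
  oint (fun u => (1 - u) ^+ i * ((1 - u)^-1 ^+ r * (x%:C - u)^-1)) =
  - two_pi_i R * (if (r <= i)%N then ((1 - x) ^+ (i - r))%:C else 0).
Proof.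
move=> x1; have xx : -1 <= x <= 1 by case/andP: x1 => -> /ltW ->.
case: leqP => [ri|ir].
  rewrite -contour_integral_subX_subV //; apply: eq_contour_integral => v v01.
  rewrite mulrA exprVn; congr (_ * _); have A0 := contour_neq1 v01.
  by rewrite -{1}(subnK ri) exprD mulfK // expf_neq0.
rewrite mulr0 -(@contour_integral_subXV_subV (r - i).-1 x x1).
apply: eq_contour_integral => v v01; have A0 := contour_neq1 v01.
rewrite prednK ?subn_gt0 // mulrA; congr (_ * _).
by rewrite -{1}(subnK (ltnW ir)) exprD mulrCA -exprMn mulfV // expr1n mulr1.
Qed.

Lemma contour_integral_poly (P : {poly R}) (r : nat) x : -1 <= x < 1 ->
  oint (fun u => polyC_eval P (1 - u) * ((1 - u)^-1 ^+ r * (x%:C - u)^-1)) =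
  - two_pi_i R * ((drop_poly r P).[1 - x])%:C.
Proof.
move=> x1; have xx : -1 <= x <= 1 by case/andP: x1 => -> /ltW ->.
have E u : polyC_eval P (1 - u) * ((1 - u)^-1 ^+ r * (x%:C - u)^-1) =
  \sum_(i < size P) (P`_i)%:C *
    ((1 - u) ^+ i * ((1 - u)^-1 ^+ r * (x%:C - u)^-1)).
  rewrite /polyC_eval horner_coef size_map_poly mulr_suml.
  by apply: eq_bigr => i _; rewrite coef_map -mulrA.
transitivity (oint (fun u => \sum_(i < size P) (P`_i)%:C *
    ((1 - u) ^+ i * ((1 - u)^-1 ^+ r * (x%:C - u)^-1)))).
  by apply: eq_contour_integral => v _; rewrite E.
rewrite (@contour_integral_sum _ (fun i => (P`_i)%:C)
  (fun i u => (1 - u) ^+ i * ((1 - u)^-1 ^+ r * (x%:C - u)^-1))); last first.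
  move=> i; apply: (ccontinuousM (contP_subX i)).
  exact: (ccontinuousM (contP_subXV r) (contP_subV xx)).
(* The truncation is summed over the same indices as [P], so that the two sums match term by
   term. *)
have DE : drop_poly r P =
    \sum_(i < size P) (if (r <= i)%N then P`_i *: 'X^(i - r) else 0).
  apply/polyP => j; rewrite coef_drop_poly coef_sum.
  have [jr|jr] := ltnP (j + r) (size P); last first.
    rewrite nth_default // big1 // => i _; case: leqP; rewrite ?coef0 // => ri.
    rewrite coefZ coefXn; case: eqP => [ji|]; last by rewrite mulr0.
    by move: (ltn_ord i) jr; rewrite ji subnK // ltnNge => /negP.
  rewrite (bigD1 (Ordinal jr)) //= leq_addl addnK coefZ coefXn eqxx mulr1.
  rewrite big1 ?addr0 // => i ij; case: leqP; rewrite ?coef0 // => ri.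
  rewrite coefZ coefXn; case: eqP => [ji|]; last by rewrite mulr0.
  by move: ij; rewrite -val_eqE /= ji subnK // eqxx.
rewrite DE horner_sum rmorph_sum mulr_sumr; apply: eq_bigr => i _.
rewrite contour_integral_monomial // mulrCA; congr (_ * _).
case: leqP => _; last by rewrite horner0 mulr0.
by rewrite hornerZ hornerXn rmorphM.
Qed.

End Contour.

(** * Orthogonality of the Jacobi polynomials *)

Section Weight.
Variable R : realType.
Implicit Types (a x : R).
Local Notation mu := (@lebesgue_measure R).

(** Monotone convergence along [-1, 1 - 1/(n+1)], where -2 sqrt(1 - x) is a primitive; the integrals
    stay below 2 sqrt 2, hence below 4. *)
Lemma integrable_powR_onem : 
  mu.-integrable `[-1, 1] (EFin \o (fun x : R => (1 - x) `^ (- (1 / 2)))).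
Proof.
pose f x : R := (1 - x) `^ (- (1 / 2)).
have mf : measurable_fun [set: R] f.
  apply: (@measurableT_comp _ _ _ _ _ _ (fun y : R => y `^ (- (1 / 2)))).
    exact: measurable_powR.
  exact: measurable_funB.
have mfD (D : set (measurableTypeR R)) : measurable_fun D (EFin \o f).
  by apply/measurable_EFinP; apply: measurable_funTS.
have f0 x : 0 <= f x by exact: powR_ge0.
apply: integrable_itv_cc; first lra.
pose e (n : nat) : R := 1 - n.+1%:R^-1.
pose F (n : nat) : set (measurableTypeR R) := `[-1, e n]%classic.
have en n : -1 <= e n < 1.
  rewrite /e; have : 0 < n.+1%:R^-1 :> R by [].
  have : n.+1%:R^-1 <= 1 :> R by rewrite invf_le1 // ler1n.
  by move: (n.+1%:R^-1) => z; lra.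
have UF : `[-1, 1[%classic = \bigcup_n F n.
  apply/seteqP; split => x /=.
    rewrite in_itv /= => /andP[x1 x2].
    have : 0 < 1 - x by lra.
    move=> /ltr_add_invr[n]; rewrite add0r => /ltW nx; exists n => //.
    by rewrite /F /= in_itv /= x1 /= /e lerBrDl -lerBrDr.
  move=> [n _]; rewrite /F /= !in_itv /= => /andP[-> xe] /=.
  by apply: le_lt_trans xe _; case/andP: (en n).
suff : mu.-integrable (\bigcup_n F n) (EFin \o f).
  rewrite -UF => h; apply: integrableS h => //.
  by apply: subset_itvr; rewrite bnd_simp.
have mF n : measurable (F n) by exact: measurable_itv.
have ndF : nondecreasing_seq F.
  move=> m n mn; apply/subsetPset; apply: subset_itvl; rewrite bnd_simp /e.
  by rewrite lerD2l lerN2 lef_pV2 ?posrE // ler_nat.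
have fE x : x < 1 -> f x = (Num.sqrt (1 - x))^-1.
  by move=> x1; rewrite /f powRN div1r powR12_sqrt // subr_ge0 ltW.
have cF x : {for x, continuous (fun y : R => Num.sqrt (1 - y))}.
  apply: (@continuous_comp _ _ _ (fun y : R => 1 - y) Num.sqrt).
    by apply: cvgB; [exact: cvg_cst|exact: cvg_id].
  exact: sqrt_continuous.
have cf x : x < 1 -> {for x, continuous f}.
  move=> x1; rewrite /prop_for /continuous_at fE //.
  have cfx : (fun y : R => (Num.sqrt (1 - y))^-1) y @[y --> x] --> (Num.sqrt (1 - x))^-1.
    by apply: cvgV; [rewrite gt_eqF // sqrtr_gt0 subr_gt0|exact: cF].
  apply: cvg_trans cfx; apply: near_eq_cvg; near=> y; rewrite fE //.
  by near: y; exact: lt_nbhsl.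
have intF n : (\int[mu]_(x in F n) (f x)%:E <= 4%:E)%E.
  have [e1 e2] := andP (en n).
  have cfn : {within `[-1, e n], continuous f}.
    apply: continuous_in_subspaceT => x; rewrite inE /= in_itv /= => /andP[_ xe].
    by apply: cf; exact: le_lt_trans e2.
  have fi : mu.-integrable (F n) (EFin \o f).
    by apply: continuous_compact_integrable => //; exact: segment_compact.
  have FE : \int[mu]_(x in F n) f x = 
      -2 * Num.sqrt (1 - e n) - -2 * Num.sqrt (1 - -1).
    apply: (@FTC2_off_seq R [::] (fun x => -2 * Num.sqrt (1 - x))) => //.
      apply: continuous_subspaceT => x; apply: cvgM; first exact: cvg_cst.
      exact: cF.
    move=> x; rewrite in_itv /= => /andP[_ xe] _; have x1 := lt_trans xe e2.
    split; first exact: cf.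
    have x1' : 0 < 1 - x by rewrite subr_gt0.
    have d1 := is_derive1_sqrt x1'.
    have d2 : is_derive x 1 (fun y : R => 1 - y) (-1).
      by apply: is_derive_eq; ring.
    have d3 := @is_derive1_comp R Num.sqrt (fun y => 1 - y) x _ _ d1 d2.
    have d4 := is_deriveZ (-2 : R) d3.
    have s0 : Num.sqrt (1 - x) != 0 by rewrite gt_eqF // sqrtr_gt0.
    have -> : f x = -2 *: ((2 * Num.sqrt (1 - x))^-1 * -1).
      by rewrite fE // /GRing.scale /=; field.
    exact: d4.
  have := @integrable_fin_num _ _ _ mu (F n) _ _ fi.
  move=> /(_ (mF n)) /fineK; rewrite -[fine _]/(\int[mu]_(x in F n) f x) => <-.
  rewrite FE lee_fin.
  have s1 : Num.sqrt (1 - -1) <= 2 :> R.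
    by rewrite -[leRHS]ger0_norm // -sqrtr_sqr ler_sqrt ?sqr_ge0 //; lra.
  have s2 := sqrtr_ge0 (1 - e n); lra.
apply/integrableP; split; first exact: mfD.
have -> : (\int[mu]_(x in \bigcup_n F n) `|(EFin \o f) x| =
    \int[mu]_(x in \bigcup_n F n) (f x)%:E)%E.
  by apply: eq_integral => x _; rewrite gee0_abs // lee_fin.
apply: (@le_lt_trans _ _ 4%:E); last exact: ltry.
have := @ge0_nondecreasing_set_cvg_integral _ _ _ F (EFin \o f) mu ndF mF
  (fun n => mfD (F n)) (fun n x _ => f0 x).
move=> h; apply: (cvge_to_le h).
by near=> n; exact: intF.
Unshelve. all: by end_near.
Qed.

(** The case a = 1/2 reduces to a = -1/2 by absorbing a factor 1 - x into [h]. *)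
Lemma integrable_weight a (h : R -> R) (M : R) : a = 1 / 2 \/ a = - (1 / 2) ->
  measurable_fun [set: R] h -> (forall x, -1 <= x <= 1 -> `|h x| <= M) ->
  mu.-integrable `[-1, 1] (EFin \o (fun x => h x * (1 - x) `^ a)).
Proof.
have D1 : measurable (`[-1, 1]%classic : set (measurableTypeR R)) by [].
have key (g : R -> R) (K : R) : measurable_fun [set: R] g ->
    (forall x, -1 <= x <= 1 -> `|g x| <= K) ->
    mu.-integrable `[-1, 1] (EFin \o (fun x => g x * (1 - x) `^ (- (1 / 2)))).
  move=> mg gK; have := integrableMr D1 (measurable_funTS mg) _ integrable_powR_onem.
  have bg : [bounded g x | x in (`[-1, 1]%classic : set R)].
    exists K; split; first exact: num_real.
    move=> y Ky x /= ; rewrite in_itv /= => /gK gx; exact: le_trans gx (ltW Ky).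
  by move=> /(_ bg); apply: eq_integrable.
move=> [->|->] mh hM; last exact: key hM.
have mh' : measurable_fun [set: R] (fun x => h x * (1 - x)).
  by apply: measurable_funM => //; exact: measurable_funB.
have hM' x : -1 <= x <= 1 -> `|h x * (1 - x)| <= M * 2.
  move=> x1; rewrite normrM ler_pM //; first exact: hM.
  by rewrite ger0_norm; lra.
have := key _ (M * 2) mh' hM'; apply: eq_integrable => // x.
rewrite inE /= in_itv /= => /andP[x1 x2]; congr (_%:E).
rewrite -mulrA; congr (_ * _).
(* At x = 1 both sides vanish, 0 to a nonzero power being 0 by convention. *)
have [x0|x0] := eqVneq (1 - x) 0.
  by rewrite x0 mul0r powR0 //; apply/eqP; lra.
rewrite -{1}[1 - x]powRr1 ?subr_ge0 // -powRD; last by rewrite x0 implybT.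
by congr (_ `^ _); lra.
Qed.

End Weight.

Section Orthogonality.
Variable R : realType.
Implicit Types (x y a k : R) (n m : nat).
Local Notation mu := (@lebesgue_measure R).

Lemma sin_natpi n : sin (n%:R * pi) = 0 :> R.
Proof.
elim: n => [|n IH]; first by rewrite mul0r sin0.
by rewrite mulrSr mulrDl mul1r sinD IH sinpi mul0r mulr0 addr0.
Qed.

Lemma within_continuous_acos : {within `[-1, 1], continuous (@acos R)}.
Proof.
(* Only one-sided continuity at the endpoints needs an argument: there closeness of [acos] follows
   from the strict monotonicity of [cos] on [0, pi], and the minimum with pi / 2 keeps the
   comparison point in that range. *)
apply/continuous_within_itvP; first lra; split.
- by move=> x; rewrite in_itv /= => x1; exact: continuous_acos.
- rewrite acosN1; apply/cvgrPdist_lt => e e0.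
  pose d := Num.min e (pi / 2).
  have pi0 : 0 < (pi : R) by exact: pi_gt0.
  have [d0 de dp] : [/\ 0 < d, d <= e & d <= pi / 2].
    by rewrite /d lt_min e0 divr_gt0 // ge_min lexx ge_min lexx orbT.
  have c1 : -1 < cos (pi - d).
    by rewrite -cospi ltr_cos ?in_itv /=; lra.
  near=> x; have x1 : -1 < x by near: x; exact: nbhs_right_gt.
  have x2 : x < cos (pi - d) by near: x; exact: nbhs_right_lt.
  have x3 : x < 1 by near: x; apply: nbhs_right_lt; lra.
  have xx : x \in `[-1, 1] by rewrite in_itv /= !ltW.
  have xx' : -1 <= x <= 1 by rewrite !ltW.
  have a1 := acos_lepi xx'; have a0 := acos_ge0 xx'.
  rewrite ger0_norm ?subr_ge0 //.
  have : pi - d < acos x.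
    by rewrite -ltr_cos ?in_itv /= ?acosK //; [lra| rewrite a0 a1].
  lra.
- rewrite acos1; apply/cvgrPdist_lt => e e0.
  pose d := Num.min e (pi / 2).
  have pi0 : 0 < (pi : R) by exact: pi_gt0.
  have [d0 de dp] : [/\ 0 < d, d <= e & d <= pi / 2].
    by rewrite /d lt_min e0 divr_gt0 // ge_min lexx ge_min lexx orbT.
  have c1 : cos d < 1.
    by rewrite -cos0 ltr_cos ?in_itv /=; lra.
  near=> x; have x1 : x < 1 by near: x; exact: nbhs_left_lt.
  have x2 : cos d < x by near: x; exact: nbhs_left_gt.
  have x3 : -1 < x by near: x; apply: nbhs_left_gt; lra.
  have xx : x \in `[-1, 1] by rewrite in_itv /= !ltW.
  have xx' : -1 <= x <= 1 by rewrite !ltW.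
  have a1 := acos_lepi xx'; have a0 := acos_ge0 xx'.
  rewrite sub0r normrN ger0_norm //.
  have : acos x < d.
    by rewrite -ltr_cos ?in_itv /= ?acosK //; [rewrite a0 a1|lra].
  lra.
Unshelve. all: by end_near. Qed.

(* A primitive of - cos (k acos x) / sqrt (1 - x^2). *)
Definition cheb_primitive k x := if k == 0 then acos x else sin (k * acos x) / k.

Lemma cheb_primitive1 k : cheb_primitive k 1 = 0.
Proof. by rewrite /cheb_primitive acos1; case: eqP => // _; rewrite mulr0 sin0 mul0r. Qed.

(** Frequencies are written as differences of naturals so that this single statement also covers the
    sums n + m + 2 and n + m + 1, as differences with 0; these are never zero and contribute
    nothing. *)
Lemma cheb_primitiveN1 n m :
  cheb_primitive (n%:R - m%:R) (-1) = if n == m then pi else 0.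
Proof.
rewrite /cheb_primitive acosN1 subr_eq0 eqr_nat; case: eqP => // _.
by rewrite mulrBl sinB !sin_natpi mulr0 mul0r subrr mul0r.
Qed.

Lemma within_continuous_cheb_primitive k :
  {within `[-1, 1], continuous (cheb_primitive k)}.
Proof.
rewrite /cheb_primitive; case: eqP => _; first exact: within_continuous_acos.
move=> x; apply: cvgM; last exact: cvg_cst.
apply: (@cvg_comp _ _ _ (fun y : subspace `[-1, 1] => k * acos y) sin).
  by apply: cvgM; [exact: cvg_cst|exact: within_continuous_acos].
exact: continuous_sin.
Qed.

Lemma is_derive_cheb_primitive k x : -1 < x < 1 ->
  is_derive x 1 (cheb_primitive k) (- (cos (k * acos x) / Num.sqrt (1 - x ^+ 2))).
Proof.
move=> x1; have da := is_derive1_acos x1.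
rewrite /cheb_primitive; case: eqP => [->|/eqP k0].
  rewrite mul0r cos0 div1r; exact: da.
have d1 := is_deriveZ k da.
have d2 := @is_derive1_comp R sin (k \*: (@acos R)) x _ _ (is_derive_sin _) d1.
have d3 := is_deriveZ k^-1 d2.
have -> : (fun y => sin (k * acos y) / k) = k^-1 \*: (sin \o (k \*: @acos R)).
  by apply/funext => y; rewrite /= /GRing.scale /= mulrC.
have -> : - (cos (k * acos x) / Num.sqrt (1 - x ^+ 2)) =
    k^-1 *: (cos ((k \*: @acos R) x) * (k *: - (Num.sqrt (1 - x ^+ 2))^-1)).
  rewrite /GRing.scale /=; field; rewrite k0 /= gt_eqF // sqrtr_gt0; nra.
exact: d3.
Qed.

(** The defining identity at z = e^(ix), with the denominator cleared; the recurrence becomes the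
    addition formula for two consecutive indices. *)
Lemma jacobi_half_cos n x :
  (jacobi n (1 / 2)).[cos x] * sin x = sin (n.+1%:R * x).
Proof.
have h : (1 / 2 : R) = 1 / 2 \/ (1 / 2 : R) = - (1 / 2) by left.
suff [] : (jacobi n (1 / 2)).[cos x] * sin x = sin (n.+1%:R * x) /\
          (jacobi n.+1 (1 / 2)).[cos x] * sin x = sin (n.+2%:R * x) by [].
elim: n => [|n [IH1 IH2]].
  have [-> -> _] := jacobi_rec 0 h; rewrite eqxx !hornerE; split=> [//|].
  have -> : 2%:R * x = x + x by ring.
  rewrite sinD; ring.
split=> //; have [_ _ ->] := jacobi_rec n h.
rewrite !(hornerD, hornerN, hornerM, hornerC, hornerX).
transitivity (2 * cos x * ((jacobi n.+1 (1 / 2)).[cos x] * sin x) -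
  (jacobi n (1 / 2)).[cos x] * sin x); first ring.
rewrite IH2 IH1.
have -> : n.+3%:R * x = n.+2%:R * x + x by rewrite [n.+3%:R]mulrSr; ring.
have -> : n.+1%:R * x = n.+2%:R * x - x by rewrite [n.+2%:R]mulrSr; ring.
rewrite !sinD sinN cosN; ring.
Qed.

(** Here z^(1/2) = e^(ix/2), whence the half angles. *)
Lemma jacobi_Nhalf_cos n x :
  (jacobi n (- (1 / 2))).[cos x] * cos (x / 2) = cos ((n%:R + 1 / 2) * x).
Proof.
have h : - (1 / 2 : R) = 1 / 2 \/ - (1 / 2 : R) = - (1 / 2) by right.
suff [] : (jacobi n (- (1 / 2))).[cos x] * cos (x / 2) = cos ((n%:R + 1 / 2) * x) /\
          (jacobi n.+1 (- (1 / 2))).[cos x] * cos (x / 2) =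
             cos ((n.+1%:R + 1 / 2) * x) by [].
elim: n => [|n [IH1 IH2]].
  have [-> -> _] := jacobi_rec 0 h.
  have /negPf-> : - (1 / 2) != 1 / 2 :> R by apply/eqP => e; lra.
  rewrite !(hornerD, hornerN, hornerM, hornerC, hornerX).
  split; first by rewrite mul1r; congr cos; field.
  have -> : (1 + 1 / 2) * x = x + x / 2 by field.
  have xE : x = x / 2 + x / 2 by field.
  move: (x / 2) xE => y ->; rewrite !cosD !sinD; have := cos2Dsin2 y.
  rewrite !expr2; move: (cos y) (sin y) => c s cs.
  transitivity ((c * c - s * s) * c - (s * c + c * s) * s + c * (c * c + s * s - 1)).
    by ring.
  by rewrite cs subrr mulr0 addr0.
split=> //; have [_ _ ->] := jacobi_rec n h.
rewrite !(hornerD, hornerN, hornerM, hornerC, hornerX).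
transitivity (2 * cos x * ((jacobi n.+1 (- (1 / 2))).[cos x] * cos (x / 2)) -
  (jacobi n (- (1 / 2))).[cos x] * cos (x / 2)); first ring.
rewrite IH2 IH1.
have -> : (n.+2%:R + 1 / 2) * x = (n.+1%:R + 1 / 2) * x + x.
  by rewrite [n.+2%:R]mulrSr; field.
have -> : (n%:R + 1 / 2) * x = (n.+1%:R + 1 / 2) * x - x.
  by rewrite [n.+1%:R]mulrSr; field.
rewrite !cosD sinN cosN; ring.
Qed.

Lemma continuous_powR_gt0 a x : 0 < x -> {for x, continuous (fun y : R => y `^ a)}.
Proof.
move=> x0; apply: differentiable_continuous; apply/derivable1_diffP.
by apply: derivable_powR; rewrite in_itv /= x0.
Qed.

Lemma measurable_horner (p : {poly R}) : measurable_fun [set: R] (fun x => p.[x]).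
Proof. by apply: continuous_measurable_fun; exact: continuous_horner. Qed.

End Orthogonality.

Section JacobiOrthogonality.
Variable R : realType.
Implicit Types (x y a k : R) (n m : nat).
Local Notation mu := (@lebesgue_measure R).

Lemma itv_norm_le x : -1 <= x <= 1 -> `|x| <= 1.
Proof. by rewrite ler_norml. Qed.

Lemma horner_bounded (p : {poly R}) (B : R) :
  exists M : R, forall x, `|x| <= B -> `|p.[x]| <= M.
Proof.
exists (\sum_(i < size p) `|p`_i| * B ^+ i) => x xB.
rewrite horner_coef; apply: le_trans (ler_norm_sum _ _ _) _.
apply: ler_sum => i _; rewrite normrM normrX ler_wpM2l //.
by rewrite lerXn2r // nnegrE ?(le_trans _ xB).
Qed.

Lemma powR_onep_bounded x : -1 <= x <= 1 -> `|(1 + x) `^ (1 / 2)| <= 2.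
Proof.
move=> /andP[x1 x2]; rewrite ger0_norm ?powR_ge0 //.
have [h|h] := leP (1 + x) 1.
  apply: le_trans (_ : (1 : R) `^ (1 / 2) <= 2).
    by apply: ge0_ler_powR; rewrite ?nnegrE; lra.
  by rewrite powR1; lra.
apply: (@le_trans _ _ (1 + x)); last lra.
by apply: ler1_powR; lra.
Qed.

Lemma measurable_powR_onep : measurable_fun [set: R] (fun x : R => (1 + x) `^ (1 / 2)).
Proof.
apply: (@measurableT_comp _ _ _ _ _ _ (fun y : R => y `^ (1 / 2))).
  exact: measurable_powR.
exact: measurable_funD.
Qed.

Lemma integrable_jacobi_weight a (p : {poly R}) : a = 1 / 2 \/ a = - (1 / 2) ->
  mu.-integrable `[-1, 1]
    (EFin \o (fun x => p.[x] * (1 - x) `^ a * (1 + x) `^ (1 / 2))).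
Proof.
move=> ha; have [M HM] := horner_bounded p 1.
have mh : measurable_fun [set: R] (fun x => p.[x] * (1 + x) `^ (1 / 2)).
  by apply: measurable_funM; [exact: measurable_horner|exact: measurable_powR_onep].
have hM x : -1 <= x <= 1 -> `|p.[x] * (1 + x) `^ (1 / 2)| <= M * 2.
  move=> x1; rewrite normrM ler_pM //; last exact: powR_onep_bounded.
  by apply: HM; exact: itv_norm_le.
have := integrable_weight ha mh hM; apply: eq_integrable => // x _ /=.
by rewrite mulrAC.
Qed.

Lemma sqrt_onem_onep x : -1 < x < 1 ->
  Num.sqrt (1 - x ^+ 2) = Num.sqrt (1 - x) * Num.sqrt (1 + x).
Proof.
move=> /andP[x1 x2]; rewrite -sqrtrM ?subr_ge0 ?ltW //; congr Num.sqrt; ring.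
Qed.

(** Product-to-sum formula at the angle acos x; the weight is sin (acos x), so one of the two sine
    denominators survives and the result is a combination of derivatives of [cheb_primitive]. *)
Lemma jacobi_mul_half n m x : -1 < x < 1 ->
  (jacobi n (1 / 2) * jacobi m (1 / 2)).[x] * (1 - x) `^ (1 / 2) * (1 + x) `^ (1 / 2) =
  1 / 2 * (cos ((n%:R - m%:R) * acos x) - cos (((n + m).+2%:R - 0%:R) * acos x)) /
  Num.sqrt (1 - x ^+ 2).
Proof.
move=> x1; have [x1a x1b] := andP x1.
have xx : -1 <= x <= 1 by rewrite !ltW.
have S0 : 0 < Num.sqrt (1 - x ^+ 2) by rewrite sqrtr_gt0; nra.
have s0 := sin_acos xx.
have c0 : cos (acos x) = x by rewrite acosK // in_itv.
have J1 := jacobi_half_cos n (acos x); have J2 := jacobi_half_cos m (acos x).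
rewrite c0 s0 in J1 J2.
have P : 1 / 2 * (cos ((n%:R - m%:R) * acos x) -
    cos (((n + m).+2%:R - 0%:R) * acos x)) =
    sin (n.+1%:R * acos x) * sin (m.+1%:R * acos x).
  have -> : (n%:R - m%:R) * acos x = n.+1%:R * acos x - m.+1%:R * acos x.
    by rewrite !mulrSr; ring.
  have -> : ((n + m).+2%:R - 0%:R) * acos x = n.+1%:R * acos x + m.+1%:R * acos x.
    by rewrite !mulrSr natrD; ring.
  by rewrite !cosD cosN sinN; field.
have W : (1 - x) `^ (1 / 2) * (1 + x) `^ (1 / 2) = Num.sqrt (1 - x ^+ 2).
  by rewrite sqrt_onem_onep // !div1r !powR12_sqrt //; lra.
rewrite P -J1 -J2 hornerM -mulrA W; field; exact: lt0r_neq0.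
Qed.

Lemma jacobi_mul_Nhalf n m x : -1 < x < 1 ->
  (jacobi n (- (1 / 2)) * jacobi m (- (1 / 2))).[x] *
    (1 - x) `^ (- (1 / 2)) * (1 + x) `^ (1 / 2) =
  (cos ((n%:R - m%:R) * acos x) + cos (((n + m).+1%:R - 0%:R) * acos x)) /
  Num.sqrt (1 - x ^+ 2).
Proof.
move=> x1; have [x1a x1b] := andP x1.
have xx : -1 <= x <= 1 by rewrite !ltW.
have s1 : 0 < Num.sqrt (1 - x) by rewrite sqrtr_gt0; lra.
have s2 : 0 < Num.sqrt (1 + x) by rewrite sqrtr_gt0; lra.
have c0 : cos (acos x) = x by rewrite acosK // in_itv.
have J1 := jacobi_Nhalf_cos n (acos x); have J2 := jacobi_Nhalf_cos m (acos x).
rewrite c0 in J1 J2.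
have P : cos ((n%:R - m%:R) * acos x) + cos (((n + m).+1%:R - 0%:R) * acos x) =
    2 * (cos ((n%:R + 1 / 2) * acos x) * cos ((m%:R + 1 / 2) * acos x)).
  have -> : (n%:R - m%:R) * acos x =
    (n%:R + 1 / 2) * acos x - (m%:R + 1 / 2) * acos x by ring.
  have -> : ((n + m).+1%:R - 0%:R) * acos x =
    (n%:R + 1 / 2) * acos x + (m%:R + 1 / 2) * acos x.
    by rewrite !mulrSr natrD; field.
  by rewrite !cosD cosN sinN; ring.
(* The half-angle formula: the denominators of the two polynomials multiply to (1 + x) / 2, which
   cancels against the weight. *)
have C2 : 2 * (cos (acos x / 2) * cos (acos x / 2)) = 1 + x.
  have xE : acos x = acos x / 2 + acos x / 2 by field.
  rewrite -[in RHS]c0 [in RHS]xE cosD; have := cos2Dsin2 (acos x / 2).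
  by rewrite !expr2; lra.
have W : (1 - x) `^ (- (1 / 2)) * (1 + x) `^ (1 / 2) = (1 + x) / Num.sqrt (1 - x ^+ 2).
  have y1 : 0 <= 1 - x by lra.
  have y2 : 0 <= 1 + x by lra.
  rewrite sqrt_onem_onep // powRN !div1r !powR12_sqrt //.
  have {2}-> : 1 + x = Num.sqrt (1 + x) ^+ 2 by rewrite sqr_sqrtr //; lra.
  by field; rewrite !lt0r_neq0.
rewrite P -J1 -J2 hornerM -mulrA W -C2; ring.
Qed.

(** Of the two cosines only the one of frequency n - m can have a nonzero integral, namely pi when n
    = m. The factor 2^(a + 1/2) is 2 or 1, which offsets the 1/2 in [jacobi_mul_half]. *)
Lemma jacobi_orthogonal a n m : a = 1 / 2 \/ a = - (1 / 2) ->
  2 `^ (a + 1 / 2) / pi * \int[mu]_(x in `[-1, 1])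
    ((jacobi n a * jacobi m a).[x] * (1 - x) `^ a * (1 + x) `^ (1 / 2)) =
  (n == m)%:R.
Proof.
move=> ha; have fi := integrable_jacobi_weight (jacobi n a * jacobi m a) ha.
set f := (fun x => _) in fi *.
have cf x : -1 < x < 1 -> {for x, continuous f}.
  move=> /andP[x1 x2]; apply: cvgM; first apply: cvgM.
  - exact: continuous_horner.
  - apply: (@cvg_comp _ _ _ (fun y : R => 1 - y) (fun y => y `^ a)).
      by apply: cvgB; [exact: cvg_cst|exact: cvg_id].
    by apply: continuous_powR_gt0; lra.
  - apply: (@cvg_comp _ _ _ (fun y : R => 1 + y) (fun y => y `^ (1 / 2))).
      by apply: cvgD; [exact: cvg_cst|exact: cvg_id].
    by apply: continuous_powR_gt0; lra.
have N11 : (-1 : R) <= 1 by lra.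
have key (F : R -> R) : {within `[-1, 1], continuous F} ->
    (forall x, -1 < x < 1 -> is_derive x 1 F (f x)) ->
    \int[mu]_(x in `[-1, 1]) f x = F 1 - F (-1).
  move=> cF dF; apply: (@FTC2_off_seq R [::] F f _ _ N11 cF fi).
  move=> x; rewrite in_itv /= => x1 _; exact: (conj (cf x x1) (dF x x1)).
have pi0 : (pi : R) != 0 by rewrite gt_eqF // pi_gt0.
case: ha => ha; rewrite ha in f fi cf key *.
- pose F x := - (1 / 2) * (cheb_primitive (n%:R - m%:R) x -
     cheb_primitive ((n + m).+2%:R - 0%:R) x).
  have cF : {within `[-1, 1], continuous F}.
    move=> x; apply: cvgM; first exact: cvg_cst.
    by apply: cvgB; exact: within_continuous_cheb_primitive.
  have dF x : -1 < x < 1 -> is_derive x 1 F (f x).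
    move=> x1; have d1 := is_derive_cheb_primitive (n%:R - m%:R) x1.
    have d2 := is_derive_cheb_primitive ((n + m).+2%:R - 0%:R) x1.
    have d3 := is_deriveZ (- (1 / 2)) (is_deriveB d1 d2).
    suff -> : f x = - (1 / 2) *: (- (cos ((n%:R - m%:R) * acos x) /
        Num.sqrt (1 - x ^+ 2)) - - (cos (((n + m).+2%:R - 0%:R) * acos x) /
        Num.sqrt (1 - x ^+ 2))) by exact: d3.
    by rewrite /f jacobi_mul_half // /GRing.scale /=; ring.
  rewrite -/f (key F cF dF) /F !cheb_primitive1 !cheb_primitiveN1 /= -splitr powRr1 //.
  by move: (pi : R) pi0 => P P0; case: eqP => _; rewrite ?mulr1n ?mulr0n; field.
- pose F x := - (cheb_primitive (n%:R - m%:R) x +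
     cheb_primitive ((n + m).+1%:R - 0%:R) x).
  have cF : {within `[-1, 1], continuous F}.
    move=> x; apply: cvgN.
    by apply: cvgD; exact: within_continuous_cheb_primitive.
  have dF x : -1 < x < 1 -> is_derive x 1 F (f x).
    move=> x1; have d1 := is_derive_cheb_primitive (n%:R - m%:R) x1.
    have d2 := is_derive_cheb_primitive ((n + m).+1%:R - 0%:R) x1.
    have d3 := is_deriveN (is_deriveD d1 d2).
    suff -> : f x = - (- (cos ((n%:R - m%:R) * acos x) /
        Num.sqrt (1 - x ^+ 2)) + - (cos (((n + m).+1%:R - 0%:R) * acos x) /
        Num.sqrt (1 - x ^+ 2))) by exact: d3.
    by rewrite /f jacobi_mul_Nhalf //; ring.
  rewrite -/f (key F cF dF) /F !cheb_primitive1 !cheb_primitiveN1 /= addNr powRr0.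
  by move: (pi : R) pi0 => P P0; case: eqP => _; rewrite ?mulr1n ?mulr0n; field.
Qed.

End JacobiOrthogonality.

(** * Evaluation of the contour integral *)

Section KernelReduction.
Variable R : realType.
Implicit Types (x alpha a : R) (T s k m r : nat).
Local Notation mu := (@lebesgue_measure R).

Definition phi_rate alpha : R := alpha + alpha ^+ 2 / 2.

Lemma phiE (F : fieldType) (alpha x : F) :
  phi alpha x = (1 + (alpha + alpha ^+ 2 / 2) * (1 - x))^-1.
Proof. by rewrite /phi div1r mulrDl addrA. Qed.

(* The factor J(u) / phi(u)^T of the integrand as a polynomial in 1 - u; the contour
   integral retains its terms of degree at least r_m. *)
Definition residue_poly alpha T (J : {poly R}) : {poly R} :=
  (1 + (phi_rate alpha)%:P * 'X) ^+ T * (J \Po (1 - 'X)).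

Lemma polyC_evalM (P Q : {poly R}) u :
  polyC_eval (P * Q) u = polyC_eval P u * polyC_eval Q u.
Proof. by rewrite /polyC_eval rmorphM hornerM. Qed.

Lemma polyC_eval_residue_poly alpha T J (u : R[i]) :
  polyC_eval (residue_poly alpha T J) (1 - u) =
  (phi alpha%:C u ^+ T)^-1 * polyC_eval J u.
Proof.
rewrite /residue_poly polyC_evalM; congr (_ * _).
  rewrite phiE exprVn invrK /polyC_eval rmorphXn rmorphD rmorph1 rmorphM /=.
  rewrite map_polyC map_polyX horner_exp !hornerE /= /phi_rate rmorphD rmorphM.
  by rewrite rmorphXn fmorphV rmorph_nat.
rewrite /polyC_eval map_comp_poly horner_comp rmorphB rmorph1 /= map_polyX.
by rewrite !hornerE subKr.
Qed.

Definition residue_kernel alpha T s k s' m x : R :=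
  phi alpha x ^+ T * (jacobi s (level_a R k)).[x] *
  (drop_poly (level_r m)
     (residue_poly alpha T (jacobi s' (level_a R m)))).[1 - x] *
  (1 - x) ^+ level_r k * (1 - x) `^ level_a R k * (1 + x) `^ (1 / 2).

Lemma level_r_gt0 k : (0 < k)%N -> (0 < level_r k)%N.
Proof. by case: k => // k _; rewrite /level_r /=. Qed.

Lemma contour_kernel (gamma : R -> R[i]) alpha T s k s' m x :
  encircling_contour gamma -> (0 < k)%N -> -1 <= x <= 1 ->
  contour_integral gamma (kernel_contour_integrand alpha T s k s' m x) =
  - two_pi_i R * (residue_kernel alpha T s k s' m x)%:C.
Proof.
(* At x = 1 the two poles merge and the partial fractions fail, but (1 - x)^(r_k) with r_k > 0 kills
   both sides. *)
move=> hg k0 /andP[x1]; rewrite le_eqVlt => /predU1P[->|x2].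
  rewrite /residue_kernel subrr expr0n eqn0Ngt level_r_gt0 //= mulr0 !mul0r mulr0.
  transitivity (contour_integral gamma (fun u => 0 * (1 - u) ^+ 0)).
    apply: eq_contour_integral => // v _; rewrite /kernel_contour_integrand.
    by rewrite subrr expr0n eqn0Ngt level_r_gt0 //= !(mul0r, mulr0).
  by rewrite contour_integralZ ?mul0r //; exact: contP_subX.
set K := phi alpha x ^+ T * (jacobi s (level_a R k)).[x] *
   (1 - x) ^+ level_r k * ((1 - x) `^ level_a R k * (1 + x) `^ (1 / 2)).
set Q := residue_poly alpha T (jacobi s' (level_a R m)).
transitivity (contour_integral gamma (fun u => polyC_eval (K *: Q) (1 - u) *
   ((1 - u)^-1 ^+ level_r m * (x%:C - u)^-1))).
  apply: eq_contour_integral => // v v01; rewrite /kernel_contour_integrand.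
  rewrite -mul_polyC polyC_evalM {2}/polyC_eval map_polyC hornerC /=.
  rewrite polyC_eval_residue_poly /K !rmorphM exprVn /=; ring.
rewrite contour_integral_poly ?x1 //; congr (_ * _%:C).
rewrite drop_polyZ hornerZ /residue_kernel /K -/Q; ring.
Qed.

Lemma phi_bounds alpha x : 0 <= alpha -> x <= 1 -> 0 <= phi alpha x <= 1.
Proof.
move=> a0 x1; rewrite phiE; have c0 : 0 <= (alpha + alpha ^+ 2 / 2) * (1 - x).
  by rewrite mulr_ge0 ?subr_ge0 // addr_ge0 // divr_ge0 // sqr_ge0.
by rewrite invr_ge0 invf_le1 ?lerDl ?ltr_wpDr // addr_ge0.
Qed.

Lemma level_aP k : level_a R k = 1 / 2 \/ level_a R k = - (1 / 2).
Proof. by rewrite /level_a; case: odd; [right|left]. Qed.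

(** The inverse is traded for a real power, known to be measurable; the two agree where the base is
    nonnegative, hence for x at most 1. *)
Lemma measurable_phi alpha : 0 <= alpha -> exists2 f : R -> R,
  measurable_fun [set: R] f & forall x, x <= 1 -> f x = phi alpha x.
Proof.
move=> a0; exists (fun x => (1 + (alpha + alpha ^+ 2 / 2) * (1 - x)) `^ (-1)).
  apply: (@measurableT_comp _ _ _ _ _ _ (fun y : R => y `^ (-1))).
    exact: measurable_powR.
  apply: measurable_funD => //; apply: measurable_funM => //.
  exact: measurable_funB.
move=> x x1; rewrite phiE powR_inv1 // addr_ge0 // mulr_ge0 ?subr_ge0 //.
by rewrite addr_ge0 // divr_ge0 // sqr_ge0.
Qed.

Lemma integrable_residue_kernel alpha T s k s' m : 0 <= alpha ->
  mu.-integrable `[-1, 1] (EFin \o residue_kernel alpha T s k s' m).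
Proof.
move=> a0; have [f mf fE] := measurable_phi a0.
pose P := jacobi s (level_a R k) * (drop_poly (level_r m)
  (residue_poly alpha T (jacobi s' (level_a R m))) \Po (1 - 'X)) *
  (1 - 'X) ^+ level_r k.
have PE x : P.[x] = (jacobi s (level_a R k)).[x] * (drop_poly (level_r m)
  (residue_poly alpha T (jacobi s' (level_a R m)))).[1 - x] *
  (1 - x) ^+ level_r k.
  by rewrite /P !hornerM horner_comp horner_exp !hornerD !hornerN !hornerC !hornerX.
have [M HM] := horner_bounded P 1.
pose h x := f x ^+ T * P.[x] * (1 + x) `^ (1 / 2).
have mh : measurable_fun [set: R] h.
  apply: measurable_funM; last exact: measurable_powR_onep.
  by apply: measurable_funM; [exact: measurable_funX|exact: measurable_horner].
have hM x : -1 <= x <= 1 -> `|h x| <= 1 * M * 2.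
  move=> x1; have [_ x2] := andP x1.
  rewrite normrM ler_pM //; last exact: powR_onep_bounded.
  rewrite normrM ler_pM //; last by apply: HM; exact: itv_norm_le.
  have /andP[p0 p1] := phi_bounds a0 x2.
  by rewrite normrX fE // ger0_norm // exprn_ile1.
have := integrable_weight (level_aP k) mh hM; apply: eq_integrable => // x.
rewrite inE /= in_itv /= => /andP[_ x2]; congr (_%:E).
rewrite /h PE fE // /residue_kernel; ring.
Qed.

Lemma cintegral_contour_kernel (gamma : R -> R[i]) alpha T s k s' m :
  encircling_contour gamma -> (0 < k)%N -> 0 <= alpha ->
  (two_pi_i R)^-1 * cintegral `[-1, 1] (fun x =>
     contour_integral gamma (kernel_contour_integrand alpha T s k s' m x)) =
  (- \int[mu]_(x in `[-1, 1]) residue_kernel alpha T s k s' m x)%:C.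
Proof.
move=> hg k0 a0; have fi := integrable_residue_kernel T s k s' m a0.
have D1 : measurable (`[-1, 1]%classic : set (measurableTypeR R)) by [].
pose F x := (residue_kernel alpha T s k s' m x)%:C.
have FE : cintegral `[-1, 1] F =
    (\int[mu]_(x in `[-1, 1]) residue_kernel alpha T s k s' m x)%:C.
  rewrite /cintegral /F; apply: complex_ext => //=.
  by rewrite Rintegral_cst // mul0r.
have Fi : cintegrable `[-1, 1] F.
  by split => //; exact: integrable0.
rewrite (@eq_cintegral R _ _ (fun x => - two_pi_i R * F x)); last first.
  by move=> x; rewrite inE /= in_itv /= => x1; rewrite contour_kernel.
rewrite cintegralZ // FE mulrA mulrN mulVf ?two_pi_i_neq0 // mulN1r.
by rewrite rmorphN.
Qed.

Definition residue_entry alpha T s k s' m : R :=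
  (2 `^ (level_a R k + 1 / 2)) / pi *
  (- (\int[mu]_(x in `[-1, 1]) residue_kernel alpha T s k s' m x) +
   if (m <= k)%N then
     \int[mu]_(x in `[-1, 1])
       ((jacobi s (level_a R k)).[x] * (jacobi s' (level_a R m)).[x] *
        (1 - x) `^ ((level_r k)%:R - (level_r m)%:R + level_a R k) *
        (1 + x) `^ (1 / 2))
   else 0).

Lemma correlation_kernelE (gamma : R -> R[i]) alpha T s k s' m :
  encircling_contour gamma -> (0 < k)%N -> 0 <= alpha ->
  correlation_kernel alpha gamma T s k s' m =
  (residue_entry alpha T s k s' m)%:C.
Proof.
move=> hg k0 a0; rewrite /correlation_kernel -mulrA cintegral_contour_kernel //.
rewrite -rmorphM -rmorphD /residue_entry mulrDr; congr (_ + _)%:C.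
by case: (m <= k)%N; rewrite ?mulr0.
Qed.

End KernelReduction.

(** * Binomial tails *)

Section BinomialTail.
Variable R : realType.
Implicit Types (z c : R) (T n k : nat).

(* (1 + z)^T times the expectation of f(X), X binomial with parameters T and
   z / (1 + z). *)
Definition binsum T z (f : nat -> R) : R :=
  \sum_(k < T.+1) 'C(T, k)%:R * z ^+ k * f k.

(** Pascal's rule, or conditioning on one trial; all moments below follow from it by induction on
    T. *)
Lemma binsumS T z f :
  binsum T.+1 z f = binsum T z f + z * binsum T z (fun k => f k.+1).
Proof.
rewrite /binsum big_ord_recl /= bin0 expr0 !mul1r.
under eq_bigr do rewrite /bump /= add1n binS natrD mulrDl mulrDl.
rewrite big_split /= addrA; congr (_ + _).
  rewrite [RHS]big_ord_recl /= bin0 expr0 !mul1r; congr (_ + _).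
  rewrite big_ord_recr /= bin_small // !mul0r addr0.
  by apply: eq_bigr => i _; rewrite /bump /= add1n.
by rewrite mulr_sumr; apply: eq_bigr => i _; rewrite exprS; ring.
Qed.

Lemma binsumD T z f g : binsum T z (fun k => f k + g k) = binsum T z f + binsum T z g.
Proof. by rewrite /binsum -big_split; apply: eq_bigr => i _; rewrite mulrDr. Qed.

Lemma binsumZ T z c f : binsum T z (fun k => c * f k) = c * binsum T z f.
Proof. by rewrite /binsum mulr_sumr; apply: eq_bigr => i _; rewrite mulrCA. Qed.

Lemma binsum_ext T z f g : f =1 g -> binsum T z f = binsum T z g.
Proof. by move=> fg; apply: eq_bigr => i _; rewrite fg. Qed.

Lemma binsum1 T z : binsum T z (fun=> 1) = (1 + z) ^+ T.
Proof.
elim: T => [|T IH]; last by rewrite binsumS IH exprS mulrDl mul1r.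
by rewrite /binsum big_ord1 bin0 !expr0 !mulr1.
Qed.

Lemma binsum_id T z : (1 + z) * binsum T z (fun k => k%:R) =
  T%:R * z * (1 + z) ^+ T.
Proof.
elim: T => [|T IH]; first by rewrite /binsum big_ord1 !mulr0 !mul0r.
rewrite binsumS (@binsum_ext _ _ (fun k => k.+1%:R) (fun k => k%:R + 1)); last first.
  by move=> k; rewrite mulrSr.
rewrite binsumD binsum1 exprS [T.+1%:R]mulrSr.
transitivity ((1 + z) * ((1 + z) * binsum T z (fun k => k%:R)) +
  (1 + z) * z * (1 + z) ^+ T); first ring.
by rewrite IH; ring.
Qed.

Lemma binsum_sqr T z : (1 + z) ^+ 2 * binsum T z (fun k => k%:R ^+ 2) =
  (T%:R * z + T%:R ^+ 2 * z ^+ 2) * (1 + z) ^+ T.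
Proof.
elim: T => [|T IH].
  by rewrite /binsum big_ord1 !expr0n /= !(mulr0, mul0r) addr0 mul0r.
rewrite binsumS (@binsum_ext _ _ (fun k => k.+1%:R ^+ 2)
   (fun k => k%:R ^+ 2 + (2 * k%:R + 1))); last by move=> k; rewrite mulrSr; ring.
rewrite !binsumD binsumZ binsum1 [(1 + z) ^+ T.+1]exprS [T.+1%:R]mulrSr.
transitivity ((1 + z) * ((1 + z) ^+ 2 * binsum T z (fun k => k%:R ^+ 2)) +
  2 * z * (1 + z) * ((1 + z) * binsum T z (fun k => k%:R)) +
  (1 + z) ^+ 2 * z * (1 + z) ^+ T); first ring.
by rewrite IH binsum_id; ring.
Qed.

(** The deviation of X from its mean T z / (1 + z), multiplied by 1 + z to clear denominators; the
    variance T z / (1 + z)^2 thus becomes T z. *)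
Lemma binsum_variance T z :
  binsum T z (fun k => (k%:R * (1 + z) - T%:R * z) ^+ 2) = T%:R * z * (1 + z) ^+ T.
Proof.
rewrite (@binsum_ext _ _ _ (fun k => (1 + z) ^+ 2 * k%:R ^+ 2 +
  ((- 2 * (T%:R * z) * (1 + z)) * k%:R + (T%:R * z) ^+ 2 * 1))); last first.
  by move=> k; ring.
rewrite !binsumD !binsumZ binsum1 binsum_sqr.
transitivity ((T%:R * z + T%:R ^+ 2 * z ^+ 2) * (1 + z) ^+ T -
  2 * (T%:R * z) * ((1 + z) * binsum T z (fun k => k%:R)) +
  (T%:R * z) ^+ 2 * (1 + z) ^+ T); first ring.
by rewrite binsum_id; ring.
Qed.

Lemma ler_binsum T z f g : 0 <= z -> (forall k, (k <= T)%N -> f k <= g k) ->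
  binsum T z f <= binsum T z g.
Proof.
move=> z0 fg; apply: ler_sum => i _; rewrite ler_wpM2l //.
  by rewrite mulr_ge0 // exprn_ge0.
by apply: fg; rewrite -ltnS.
Qed.

(* The probability that X >= n. *)
Definition bintail T n z : R :=
  binsum T z (fun k => (n <= k)%:R) / (1 + z) ^+ T.

Lemma bintail_ge0 T n z : 0 <= z -> 0 <= bintail T n z.
Proof.
move=> z0; rewrite divr_ge0 ?exprn_ge0 ?addr_ge0 //; apply: sumr_ge0 => i _.
by rewrite !mulr_ge0 // exprn_ge0.
Qed.

Lemma bintail_le1 T n z : 0 <= z -> bintail T n z <= 1.
Proof.
move=> z0; rewrite ler_pdivrMr ?exprn_gt0 ?ltr_wpDr // mul1r -binsum1.
by apply: ler_binsum => // k _; case: leq; rewrite ?ler01.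
Qed.

Lemma bintail_chebyshev T n z : 0 <= z -> T%:R * z < n%:R * (1 + z) ->
  bintail T n z <= T%:R * z / (n%:R * (1 + z) - T%:R * z) ^+ 2.
Proof.
move=> z0 h; have d0 : 0 < n%:R * (1 + z) - T%:R * z by rewrite subr_gt0.
have p0 : 0 < (1 + z) ^+ T by rewrite exprn_gt0 // ltr_wpDr.
rewrite ler_pdivrMr // mulrAC ler_pdivlMr ?exprn_gt0 // -binsum_variance.
rewrite mulrC -binsumZ; apply: ler_binsum => // k _.
case: leqP => [nk|_]; last by rewrite mulr0 sqr_ge0.
have e : n%:R * (1 + z) - T%:R * z <= k%:R * (1 + z) - T%:R * z.
  by rewrite lerD2r ler_wpM2r ?ler_nat // addr_ge0.
by rewrite mulr1 lerXn2r // nnegrE ltW // (lt_le_trans d0).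
Qed.

Lemma bintail_chebyshev_compl T n z : 0 <= z -> n%:R * (1 + z) < T%:R * z ->
  1 - bintail T n z <= T%:R * z / (T%:R * z - n%:R * (1 + z)) ^+ 2.
Proof.
move=> z0 h; have d0 : 0 < T%:R * z - n%:R * (1 + z) by rewrite subr_gt0.
have p0 : 0 < (1 + z) ^+ T by rewrite exprn_gt0 // ltr_wpDr.
have -> : 1 - bintail T n z = binsum T z (fun k => (k < n)%:R) / (1 + z) ^+ T.
  apply/eqP; rewrite subr_eq -mulrDl -binsumD -binsum1; apply/eqP.
  rewrite (@binsum_ext _ _ (fun k => (k < n)%:R + (n <= k)%:R) (fun=> 1)).
    by rewrite divff // binsum1 lt0r_neq0.
  by move=> k; case: leqP => _; rewrite ?addr0 ?add0r.
rewrite ler_pdivrMr // mulrAC ler_pdivlMr ?exprn_gt0 // -binsum_variance.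
rewrite mulrC -binsumZ; apply: ler_binsum => // k _.
case: ltnP => [kn|_]; last by rewrite mulr0 sqr_ge0.
rewrite mulr1 -[leRHS]sqrrN opprB.
have e : T%:R * z - n%:R * (1 + z) <= T%:R * z - k%:R * (1 + z).
  by rewrite lerD2l lerN2 ler_wpM2r ?ler_nat ?addr_ge0 // ltnW.
by rewrite lerXn2r // nnegrE ltW // (lt_le_trans d0).
Qed.

(** For n <= i <= T one has z^i <= z^n (1 + z)^T, and 2^T is the sum of the binomial coefficients,
    written as a [binsum] at 1 to compare termwise. *)
Lemma bintail_le_expr T n z : 0 <= z -> bintail T n z <= 2 ^+ T * z ^+ n.
Proof.
move=> z0; have p0 : 0 < (1 + z) ^+ T by rewrite exprn_gt0 // ltr_wpDr.
have q1 : 1 <= 1 + z by rewrite lerDl.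
rewrite ler_pdivrMr // -mulrA.
have -> : 2 ^+ T = binsum T 1 (fun=> 1) :> R by rewrite binsum1.
rewrite mulrC -binsumZ; apply: ler_sum => i _; rewrite expr1n mulr1 -mulrA.
rewrite ler_wpM2l //; case: leqP => [ni|_]; last first.
  by rewrite mulr0 ?mulr1 !mulr_ge0 ?exprn_ge0 ?addr_ge0.
rewrite !mulr1 -{1}(subnKC ni) exprD ler_wpM2l ?exprn_ge0 //.
apply: le_trans (_ : (1 + z) ^+ (i - n) <= _).
  have z1 : z <= 1 + z by rewrite lerDr.
  by rewrite lerXn2r // nnegrE // addr_ge0.
by apply: ler_weXn2l => //; rewrite leq_subLR (leq_trans _ (leq_addl _ _)) // -ltnS.
Qed.

(** The factor y^n undoes the shift of exponents made by [drop_poly], leaving exactly the terms of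
    the binomial expansion with k >= n. *)
Lemma horner_drop_linear_exp c T n y :
  (drop_poly n ((1 + c%:P * 'X) ^+ T)).[y] * y ^+ n =
  binsum T (c * y) (fun k => (n <= k)%:R).
Proof.
have -> : (1 + c%:P * 'X) ^+ T = \sum_(k < T.+1) ('C(T, k)%:R * c ^+ k) *: 'X^k.
  rewrite exprDn; apply: eq_bigr => i _.
  by rewrite expr1n mul1r exprMn -polyC_exp mul_polyC -scaler_nat scalerA.
rewrite drop_poly_sum horner_sum mulr_suml; apply: eq_bigr => i _.
rewrite drop_polyZ hornerZ -[X in drop_poly _ X]mul1r drop_polyMXn hornerM hornerXn.
case: leqP => [ni|ni].
  have -> : (n - i = 0)%N by apply/eqP; rewrite subn_eq0.
  by rewrite drop_poly0l hornerC mul1r mulr1 -mulrA -exprD subnK // exprMn mulrA.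
rewrite mulr0 drop_poly_eq0 ?horner0 ?mul0r ?mulr0 ?mul0r //.
by rewrite size_poly1 subn_gt0.
Qed.

End BinomialTail.

(** * Dominated convergence and limits of binomial tails *)

Section Limits.
Variable R : realType.
Implicit Types (x z c t l : R).
Local Notation mu := (@lebesgue_measure R).

(** The exceptional point [p] will be the threshold theta, where the limit of the tails is not
    determined. *)
Lemma Rintegral_dominated_cvg (a b p : R) (f_ : nat -> R -> R) (f g : R -> R) :
  (forall n, mu.-integrable `[a, b] (EFin \o f_ n)) ->
  measurable_fun (`[a, b]%classic : set (measurableTypeR R)) f ->
  mu.-integrable `[a, b] (EFin \o g) ->
  (forall x, a <= x <= b -> x != p -> f_ ^~ x @ \oo --> f x) ->
  (\forall n \near \oo, forall x, a <= x <= b -> `|f_ n x| <= g x) ->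
  mu.-integrable `[a, b] (EFin \o f) /\
  (fun n => \int[mu]_(x in `[a, b]) f_ n x) @ \oo --> \int[mu]_(x in `[a, b]) f x.
Proof.
move=> fi mf gi fcvg [N _ HN].
have mD : measurable (`[a, b]%classic : set (measurableTypeR R)) by [].
(* The domination holds only eventually, so the sequence is shifted. *)
pose F n := EFin \o f_ (n + N)%N.
have mF n : measurable_fun (`[a, b]%classic : set (measurableTypeR R)) (F n).
  exact: (measurable_int mu (fi (n + N)%N)).
have mfE : measurable_fun (`[a, b]%classic : set (measurableTypeR R)) (EFin \o f).
  exact/measurable_EFinP.
have Fcvg : {ae mu, forall x, (`[a, b]%classic : set R) x -> F ^~ x @ \oo --> (EFin \o f) x}.
  exists [set p]; split; first exact: measurable_set1.
    exact: lebesgue_measure_set1.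
  move=> x /= /not_implyP[]; rewrite in_itv /= => xab nc; apply: contrapT => xp.
  apply: nc; apply: cvg_EFin; first by near=> n.
  have := fcvg x xab (introN eqP xp).
  by rewrite -(cvg_shiftn N).
have Fdom : {ae mu, forall x n, (`[a, b]%classic : set R) x -> (`|F n x| <= (EFin \o g) x)%E}.
  apply: aeW => x n /=; rewrite in_itv /= => xab; rewrite lee_fin.
  by apply: HN => //=; exact: leq_addl.
have [fint _ cv] := dominated_convergence mD mF mfE Fcvg gi Fdom.
split => //; rewrite -(cvg_shiftn N).
have ffin : (\int[mu]_(x in `[a, b]) (EFin \o f) x)%E \is a fin_num.
  exact: integrable_fin_num.
have := cv; rewrite -(fineK ffin) => /fine_cvg; exact.
Unshelve. all: by end_near. Qed.

Section BinomialLimits.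
Variables (t l : R) (T n : nat -> nat).
Hypothesis l0 : 0 < l.
Hypothesis hT : (fun N => (T N)%:R / N%:R : R) @ \oo --> t.
Hypothesis hn : (fun N => (n N)%:R / N%:R : R) @ \oo --> l.

Lemma cvg_natV : (fun N : nat => N%:R^-1 : R) @ \oo --> 0.
Proof.
rewrite -(cvg_shiftn 1); have := @cvg_harmonic R.
by apply: cvg_trans; apply: near_eq_cvg; near=> N; rewrite /harmonic /= addn1.
Unshelve. all: by end_near. Qed.

(** The numerator is of order N and the denominator of order N^2. *)
Lemma cvg_chebyshev_bound z : l * (1 + z) - t * z != 0 ->
  (fun N => (T N)%:R * z / ((n N)%:R * (1 + z) - (T N)%:R * z) ^+ 2 : R) @ \oo --> 0.
Proof.
move=> d0.
have c1 : (fun N => (n N)%:R / N%:R * (1 + z) - (T N)%:R / N%:R * z : R) @ \oo -->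
    l * (1 + z) - t * z.
  by apply: cvgB; apply: cvgM => //; exact: cvg_cst.
have c2 : (fun N => ((n N)%:R / N%:R * (1 + z) - (T N)%:R / N%:R * z)^-1 : R) @ \oo -->
    (l * (1 + z) - t * z)^-1 by apply: cvgV.
have c3 : (fun N : nat => N%:R^-1 * ((T N)%:R / N%:R * z *
    (((n N)%:R / N%:R * (1 + z) - (T N)%:R / N%:R * z)^-1 *
     ((n N)%:R / N%:R * (1 + z) - (T N)%:R / N%:R * z)^-1)) : R) @ \oo --> 0.
  rewrite -[X in _ --> X](mul0r (t * z * ((l * (1 + z) - t * z)^-1 *
    (l * (1 + z) - t * z)^-1))).
  apply: cvgM; first exact: cvg_natV.
  by apply: cvgM; [apply: cvgM => //; exact: cvg_cst|exact: cvgM].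
apply: cvg_trans c3; apply: near_eq_cvg; near=> N.
have N0 : N%:R != 0 :> R.
  by rewrite pnatr_eq0 -lt0n; near: N; exact: nbhs_infty_gt.
rewrite /=.
have -> : (n N)%:R / N%:R * (1 + z) - (T N)%:R / N%:R * z =
  ((n N)%:R * (1 + z) - (T N)%:R * z) / N%:R by ring.
rewrite invfM invrK -exprVn.
move: ((n N)%:R * (1 + z) - (T N)%:R * z)^-1 => e; field; exact: N0.
Unshelve. all: by end_near. Qed.

Lemma bintail_cvg0 z : 0 <= z -> t * z < l * (1 + z) ->
  (fun N => bintail (T N) (n N) z) @ \oo --> (0 : R).
Proof.
move=> z0 h; have d0 : l * (1 + z) - t * z != 0 by rewrite gt_eqF // subr_gt0.
apply: (@squeeze_cvgr _ _ _ _ (fun=> 0) (fun N =>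
  (T N)%:R * z / ((n N)%:R * (1 + z) - (T N)%:R * z) ^+ 2)).
- have c1 : (fun N => (n N)%:R / N%:R * (1 + z) - (T N)%:R / N%:R * z : R) @ \oo -->
    l * (1 + z) - t * z.
    by apply: cvgB; apply: cvgM => //; exact: cvg_cst.
  near=> N; rewrite bintail_ge0 //=; apply: bintail_chebyshev => //.
  have N0 : 0 < N%:R :> R.
    by rewrite ltr0n; near: N; exact: nbhs_infty_gt.
  rewrite -subr_gt0 -(pmulr_lgt0 _ (_ : 0 < N%:R^-1)) ?invr_gt0 //.
  have -> : ((n N)%:R * (1 + z) - (T N)%:R * z) / N%:R =
    (n N)%:R / N%:R * (1 + z) - (T N)%:R / N%:R * z by ring.
  by near: N; apply: (cvgr_gt _ c1); rewrite subr_gt0.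
- exact: cvg_cst.
- exact: cvg_chebyshev_bound.
Unshelve. all: by end_near. Qed.

Lemma bintail_cvg1 z : 0 <= z -> l * (1 + z) < t * z ->
  (fun N => bintail (T N) (n N) z) @ \oo --> (1 : R).
Proof.
move=> z0 h; have d0 : l * (1 + z) - t * z != 0 by rewrite lt_eqF // subr_lt0.
apply: (@squeeze_cvgr _ _ _ _ (fun N => 1 -
  (T N)%:R * z / ((n N)%:R * (1 + z) - (T N)%:R * z) ^+ 2) (fun=> 1)).
- have c1 : (fun N => (n N)%:R / N%:R * (1 + z) - (T N)%:R / N%:R * z : R) @ \oo -->
    l * (1 + z) - t * z.
    by apply: cvgB; apply: cvgM => //; exact: cvg_cst.
  near=> N; rewrite bintail_le1 //= andbT lerBlDr -lerBlDl.
  rewrite -sqrrN opprB; apply: bintail_chebyshev_compl => //.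
  have N0 : 0 < N%:R :> R.
    by rewrite ltr0n; near: N; exact: nbhs_infty_gt.
  rewrite -subr_lt0 -(pmulr_llt0 _ (_ : 0 < N%:R^-1)) ?invr_gt0 //.
  have -> : ((n N)%:R * (1 + z) - (T N)%:R * z) / N%:R =
    (n N)%:R / N%:R * (1 + z) - (T N)%:R / N%:R * z by ring.
  by near: N; apply: (cvgr_lt _ c1); rewrite subr_lt0.
- rewrite -[X in _ --> X]subr0; apply: cvgB; first exact: cvg_cst.
  exact: cvg_chebyshev_bound.
- exact: cvg_cst.
Unshelve. all: by end_near. Qed.

(* This is what keeps the integrand integrable near x = 1 when k < m, where the
   factor (1 - x)^(r_k - r_m) is singular. *)
Lemma bintail_uniform_bound (D : nat) : exists2 C : R, 0 <= C &
  \forall N \near \oo, forall z, 0 <= z -> bintail (T N) (n N) z <= C * z ^+ D.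
Proof.
(* Eventually T < (t + 1) N and n - D > (l / 2) N, so this [m] gives T <= m (n - D). *)
have [m hm] : exists m : nat, (t + 1) / (l / 2) < m%:R.
  by exists (Num.truncn ((t + 1) / (l / 2))).+1; exact: truncnS_gt.
have c1 : (fun N => (n N)%:R / N%:R - D%:R * N%:R^-1 : R) @ \oo --> l.
  rewrite -[X in _ --> X]subr0 -[X in _ --> _ - X](mulr0 D%:R).
  by apply: cvgB => //; apply: cvgM; [exact: cvg_cst|exact: cvg_natV].
exists (2 ^+ (m * D)); first exact: exprn_ge0.
near=> N => z z0.
have N0 : 0 < N%:R :> R by rewrite ltr0n; near: N; exact: nbhs_infty_gt.
have h1 : (T N)%:R / N%:R < t + 1.
  by near: N; apply: (cvgr_lt _ hT); rewrite ltrDl.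
have h2 : l / 2 < (n N)%:R / N%:R - D%:R * N%:R^-1.
  by near: N; apply: (cvgr_gt _ c1); rewrite ltr_pdivrMr // ltr_pMr // ltr1n.
rewrite ltr_pdivrMr // in h1; rewrite -mulrBl ltr_pdivlMr // in h2.
have lp : 0 < l / 2 by rewrite divr_gt0.
rewrite ltr_pdivrMr // in hm.
have nD : (D <= n N)%N.
  rewrite -(ler_nat R) -subr_ge0; apply: ltW; apply: lt_trans h2.
  by rewrite mulr_gt0.
have TD : (T N <= m * (n N - D))%N.
  rewrite -(ler_nat R) natrM natrB //; apply: ltW; apply: lt_le_trans h1 _.
  apply: le_trans (_ : m%:R * (l / 2) * N%:R <= _).
    by rewrite ler_wpM2r // ltW.
  by rewrite -mulrA ler_wpM2l // ltW.
(* Below the cutoff, 2^T z^(n - D) <= 1 and z^D remains; above it, 2^(m D) z^D is at least 1 and the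
   trivial bound suffices. *)
have [zs|zl] := leP z (2 ^- m).
  apply: le_trans (bintail_le_expr _ _ z0) _.
  rewrite -{1}(subnK nD) exprD mulrA ler_wpM2r ?exprn_ge0 //.
  apply: le_trans (_ : 2 ^+ T N * (2 ^- m) ^+ (n N - D) <= _).
    by rewrite ler_wpM2l ?exprn_ge0 // lerXn2r // nnegrE invr_ge0 exprn_ge0.
  rewrite exprVn -exprM.
  apply: (@le_trans _ _ 1); last by apply: exprn_ege1; rewrite ler1n.
  by rewrite ler_pdivrMr ?exprn_gt0 // mul1r ler_weXn2l // ler1n.
apply: le_trans (bintail_le1 _ _ z0) _.
rewrite exprM -exprMn; apply: exprn_ege1.
by rewrite -ler_pdivrMl ?exprn_gt0 // mulr1 ltW.
Unshelve. all: by end_near. Qed.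

End BinomialLimits.
End Limits.

(** * Limits of the entries *)

Section KernelLimit.
Variable R : realType.
Implicit Types (x y alpha t l theta a : R).
Local Notation mu := (@lebesgue_measure R).

(** A factor y^i of [J] lowers the truncation threshold from r to r - i; for i > r nothing is cut,
    in agreement with truncated subtraction. *)
Lemma horner_drop_mul (P J : {poly R}) (r : nat) y :
  (drop_poly r (P * J)).[y] * y ^+ r =
  \sum_(i < size J) J`_i * y ^+ i * ((drop_poly (r - i) P).[y] * y ^+ (r - i)).
Proof.
rewrite -{1}(coefK J) poly_def mulr_sumr drop_poly_sum horner_sum mulr_suml.
apply: eq_bigr => i _; rewrite -scalerAr drop_polyZ hornerZ drop_polyMXn.
rewrite hornerM hornerXn -!mulrA; congr (_ * _); rewrite [RHS]mulrCA; congr (_ * _).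
rewrite -!exprD; congr (_ ^+ _); lia.
Qed.

Lemma residue_kernelE alpha T s k s' m x : 0 <= alpha -> x < 1 ->
  residue_kernel alpha T s k s' m x =
  (jacobi s (level_a R k)).[x] * (1 + x) `^ (1 / 2) * (1 - x) `^ level_a R k *
  ((1 - x) ^+ level_r k / (1 - x) ^+ level_r m) *
  \sum_(i < size (jacobi s' (level_a R m) \Po (1 - 'X)))
    (jacobi s' (level_a R m) \Po (1 - 'X))`_i * (1 - x) ^+ i *
    bintail T (level_r m - i) (phi_rate alpha * (1 - x)).
Proof.
move=> a0 x1; have y0 : 0 < 1 - x by rewrite subr_gt0.
have c0 : 0 <= phi_rate alpha by rewrite addr_ge0 // divr_ge0 // sqr_ge0.
set J := _ \Po _; set r := level_r m.
have yr : (1 - x) ^+ r != 0 by rewrite expf_neq0 // gt_eqF.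
have p0 : (1 + phi_rate alpha * (1 - x)) ^+ T != 0.
  by rewrite expf_neq0 // gt_eqF // ltr_wpDr // mulr_ge0 // ltW.
have E : (drop_poly r (residue_poly alpha T (jacobi s' (level_a R m)))).[1 - x] *
    (1 - x) ^+ r = (1 + phi_rate alpha * (1 - x)) ^+ T *
    \sum_(i < size J) J`_i * (1 - x) ^+ i *
      bintail T (r - i) (phi_rate alpha * (1 - x)).
  rewrite /residue_poly -/J horner_drop_mul mulr_sumr; apply: eq_bigr => i _.
  rewrite horner_drop_linear_exp /bintail [RHS]mulrCA; congr (_ * _).
  by rewrite mulrCA mulfV // mulr1.
rewrite /residue_kernel phiE -/(phi_rate alpha) exprVn -/r.
move: E; move: (_.[1 - x]) (\sum_(i < _) _) => d S E.
rewrite -[d](mulfK yr) E.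
move: yr p0; move: ((1 - x) ^+ r) ((1 + phi_rate alpha * (1 - x)) ^+ T) => Y P yr p0.
field; by rewrite yr p0.
Qed.

(** As l > 0, eventually n exceeds i and the truncated subtraction is the true one. *)
Lemma cvg_subn (n : nat -> nat) (i : nat) l :
  (fun N => (n N)%:R / N%:R : R) @ \oo --> l -> 0 < l ->
  (fun N => (n N - i)%:R / N%:R : R) @ \oo --> l.
Proof.
move=> hn l0.
have c1 : (fun N => (n N)%:R / N%:R - i%:R * N%:R^-1 : R) @ \oo --> l.
  rewrite -[X in _ --> X]subr0 -[X in _ --> _ - X](mulr0 i%:R).
  by apply: cvgB => //; apply: cvgM; [exact: cvg_cst|exact: cvg_natV].
apply: cvg_trans (c1); apply: near_eq_cvg; near=> N.
have N0 : 0 < N%:R :> R by rewrite ltr0n; near: N; exact: nbhs_infty_gt.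
have h2 : 0 < (n N)%:R / N%:R - i%:R * N%:R^-1 :> R.
  by near: N; apply: (cvgr_gt _ c1).
rewrite -mulrBl pmulr_lgt0 ?invr_gt0 // subr_gt0 ltr_nat in h2.
by rewrite natrB 1?ltnW // mulrBl.
Unshelve. all: by end_near. Qed.

End KernelLimit.

Section KernelIntegralLimit.
Variables (R : realType) (alpha t l theta a a' : R) (s s' D E : nat).
Variables (T k m : nat -> nat).
Local Notation mu := (@lebesgue_measure R).
Hypothesis alpha0 : 0 <= alpha.
Hypothesis l0 : 0 < l.
Hypothesis hT : (fun N => (T N)%:R / N%:R : R) @ \oo --> t.
Hypothesis hm : (fun N => (level_r (m N))%:R / N%:R : R) @ \oo --> l.
Hypothesis hk0 : forall N, (0 < k N)%N.
Hypothesis hkm : forall N, (level_r (k N) + D = level_r (m N) + E)%N.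
Hypothesis hka : forall N, level_a R (k N) = a.
Hypothesis hma : forall N, level_a R (m N) = a'.
Hypothesis theta1 : -1 <= theta <= 1.
Let c := phi_rate alpha.
Hypothesis below_theta : forall x : R, -1 <= x < theta ->
  l * (1 + c * (1 - x)) < t * (c * (1 - x)).
Hypothesis above_theta : forall x : R, theta < x <= 1 ->
  t * (c * (1 - x)) < l * (1 + c * (1 - x)).

Let c0 : 0 <= c.
Proof. by rewrite addr_ge0 // divr_ge0 // sqr_ge0. Qed.

Let J : {poly R} := jacobi s' a' \Po (1 - 'X).

(* E - D stands for r_k - r_m, split into naturals. *)
Definition limit_integrand (x : R) : R :=
  (jacobi s a).[x] * (jacobi s' a').[x] * (1 - x) `^ (E%:R - D%:R + a) *
  (1 + x) `^ (1 / 2).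

Lemma measurable_limit_integrand : measurable_fun [set: R] limit_integrand.
Proof.
apply: measurable_funM; last exact: measurable_powR_onep.
apply: measurable_funM; first by apply: measurable_funM; exact: measurable_horner.
apply: (@measurableT_comp _ _ _ _ _ _ (fun y : R => y `^ (E%:R - D%:R + a))).
  exact: measurable_powR.
exact: measurable_funB.
Qed.

Let ha : a = 1 / 2 \/ a = - (1 / 2).
Proof. by rewrite -(hka 0); exact: level_aP. Qed.

Lemma limit_integrandE (x : R) : x < 1 -> limit_integrand x =
  (jacobi s a).[x] * (1 + x) `^ (1 / 2) * (1 - x) `^ a *
  ((1 - x) ^+ E / (1 - x) ^+ D) * (jacobi s' a').[x].
Proof.
move=> x1; have y0 : 0 < 1 - x by rewrite subr_gt0.
rewrite /limit_integrand powRD; last by rewrite (gt_eqF y0) implybT.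
rewrite powRD; last by rewrite (gt_eqF y0) implybT.
rewrite powR_mulrn ?ltW // powR_invn ?ltW //; ring.
Qed.

Lemma level_ratio (x : R) N : x < 1 ->
  (1 - x) ^+ level_r (k N) / (1 - x) ^+ level_r (m N) =
  (1 - x) ^+ E / (1 - x) ^+ D.
Proof.
move=> x1; have y0 : 1 - x != 0 by rewrite gt_eqF // subr_gt0.
apply/eqP; rewrite eqr_div ?expf_neq0 // -!exprD; apply/eqP.
by congr (_ ^+ _); rewrite hkm addnC.
Qed.

Lemma residue_kernel_eq N (x : R) : x < 1 ->
  residue_kernel alpha (T N) s (k N) s' (m N) x =
  (jacobi s a).[x] * (1 + x) `^ (1 / 2) * (1 - x) `^ a *
  ((1 - x) ^+ E / (1 - x) ^+ D) *
  \sum_(i < size J) J`_i * (1 - x) ^+ i *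
    bintail (T N) (level_r (m N) - i) (c * (1 - x)).
Proof. by move=> x1; rewrite residue_kernelE // hka hma level_ratio. Qed.

Lemma residue_kernel1 N : residue_kernel alpha (T N) s (k N) s' (m N) 1 = 0.
Proof.
rewrite /residue_kernel subrr expr0n eqn0Ngt level_r_gt0 //=.
by rewrite !(mulr0, mul0r).
Qed.

(** All shifted tails have the same limit, 0 or 1, so the sum over the coefficients of [J]
    reassembles the Jacobi polynomial. *)
Lemma residue_kernel_cvg (x : R) : -1 <= x <= 1 -> x != theta ->
  (fun N => residue_kernel alpha (T N) s (k N) s' (m N) x) @ \oo -->
  limit_integrand x * (x < theta)%R%:R.
Proof.
(* At x = 1 the kernel is 0 for all N, and the indicator is 0 as well because theta <= 1. *)
move=> /andP[x1]; rewrite le_eqVlt => /predU1P[-> _|x2 xt].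
  have -> : (1 < theta) = false by apply/negbTE; rewrite -leNgt; case/andP: theta1.
  rewrite mulr0; under eq_cvg do rewrite residue_kernel1; exact: cvg_cst.
have z0 : 0 <= c * (1 - x) by rewrite mulr_ge0 // subr_ge0 ltW.
have tailc (i : nat) : (fun N => bintail (T N) (level_r (m N) - i) (c * (1 - x)))
    @ \oo --> ((x < theta)%R%:R : R).
  have hmi := cvg_subn i hm l0.
  move: xt; rewrite neq_lt => /orP[xt|xt].
    rewrite xt; apply: (bintail_cvg1 hT hmi) => //.
    by apply: below_theta; rewrite x1.
  rewrite ltNge ltW //=; apply: (bintail_cvg0 hT hmi) => //.
  by apply: above_theta; rewrite xt ltW.
pose K := (jacobi s a).[x] * (1 + x) `^ (1 / 2) * (1 - x) `^ a *
  ((1 - x) ^+ E / (1 - x) ^+ D).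
have -> : limit_integrand x * (x < theta)%R%:R =
    K * ((jacobi s' a').[x] * (x < theta)%R%:R).
  by rewrite limit_integrandE // /K; ring.
have -> : (jacobi s' a').[x] * (x < theta)%R%:R =
    \sum_(i < size J) J`_i * (1 - x) ^+ i * (x < theta)%R%:R :> R.
  rewrite -mulr_suml -horner_coef /J horner_comp; congr (_.[_] * _).
  by rewrite !(hornerD, hornerN, hornerC, hornerX) subKr.
have sumc : (fun N => \sum_(i < size J) J`_i * (1 - x) ^+ i *
    bintail (T N) (level_r (m N) - i) (c * (1 - x))) @ \oo -->
    \sum_(i < size J) J`_i * (1 - x) ^+ i * (x < theta)%R%:R.
  apply: cvg_big => [|i _].
    by move=> y; apply: cvgD; [exact: cvg_fst|exact: cvg_snd].
  by apply: cvgM; [exact: cvg_cst|exact: tailc].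
have : (fun N => K * \sum_(i < size J) J`_i * (1 - x) ^+ i *
    bintail (T N) (level_r (m N) - i) (c * (1 - x))) @ \oo -->
    K * \sum_(i < size J) J`_i * (1 - x) ^+ i * (x < theta)%R%:R.
  by apply: cvgM => //; exact: cvg_cst.
apply: cvg_trans; apply: near_eq_cvg; near=> N.
by rewrite residue_kernel_eq.
Unshelve. all: by end_near. Qed.

(** The tail bound of order [D] cancels the singular (1 - x)^(-D); all other factors but the weight
    are bounded on [-1, 1]. *)
Lemma residue_kernel_bounded : exists2 C : R, 0 <= C &
  \forall N \near \oo, forall x, -1 <= x <= 1 ->
    `|residue_kernel alpha (T N) s (k N) s' (m N) x| <= C * (1 - x) `^ a.
Proof.
have [M HM] := horner_bounded (jacobi s a) 1.
have M0 : 0 <= M.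
  by apply: le_trans (normr_ge0 _) (HM 0 _); rewrite normr0.
have Ci (i : 'I_(size J)) : {C : R | 0 <= C & \forall N \near \oo, forall z,
    0 <= z -> bintail (T N) (level_r (m N) - i) z <= C * z ^+ D}.
  apply: cid2; exact: (bintail_uniform_bound l0 hT (cvg_subn i hm l0) D).
pose C i := s2val (Ci i).
(* Here 2 bounds 1 - x, and c^D comes from the tail being evaluated at c (1 - x). *)
pose B := \sum_(i < size J) `|J`_i| * 2 ^+ i * (C i * c ^+ D).
have B0 : 0 <= B.
  apply: sumr_ge0 => i _; rewrite !mulr_ge0 ?exprn_ge0 //.
  exact: (s2valP (Ci i)).
exists (M * 2 * 2 ^+ E * B); first by rewrite !mulr_ge0 ?exprn_ge0.
have /filter_forall near_all : forall i : 'I_(size J), \forall N \near \oo,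
    forall z, 0 <= z -> bintail (T N) (level_r (m N) - i) z <= C i * z ^+ D.
  by move=> i; exact: (s2valP' (Ci i)).
near=> N => x /andP[x1]; rewrite le_eqVlt => /predU1P[->|x2].
  rewrite residue_kernel1 normr0 mulr_ge0 ?powR_ge0 //.
  by rewrite !mulr_ge0 ?exprn_ge0.
have hN : forall (i : 'I_(size J)) z, 0 <= z ->
  bintail (T N) (level_r (m N) - i) z <= C i * z ^+ D by near: N.
have xx : -1 <= x <= 1 by rewrite x1 ltW.
have y0 : 0 < 1 - x by rewrite subr_gt0.
have y2 : 1 - x <= 2 by lra.
have z0 : 0 <= c * (1 - x) by rewrite mulr_ge0 // ltW.
rewrite residue_kernel_eq //; set S := \sum_(i < _) _.
have -> : (jacobi s a).[x] * (1 + x) `^ (1 / 2) * (1 - x) `^ a *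
    ((1 - x) ^+ E / (1 - x) ^+ D) * S =
  (jacobi s a).[x] * (1 + x) `^ (1 / 2) *
    ((1 - x) `^ a * ((1 - x) ^+ E / (1 - x) ^+ D * S)) by ring.
rewrite normrM [`|(jacobi s a).[x] * _|]normrM [`|(1 - x) `^ a * _|]normrM.
rewrite [`|(1 - x) `^ a|]ger0_norm ?powR_ge0 //.
have SB : `|(1 - x) ^+ E / (1 - x) ^+ D * S| <= 2 ^+ E * B.
  have yD : 0 < (1 - x) ^+ D by rewrite exprn_gt0.
  have SB' : `|S| <= B * (1 - x) ^+ D.
    rewrite /S /B mulr_suml; apply: le_trans (ler_norm_sum _ _ _) _.
    apply: ler_sum => i _.
    rewrite [`|_ * bintail _ _ _|]normrM [`|J`_i * _|]normrM normrX.
    rewrite -!mulrA ler_wpM2l //.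
    rewrite [`|1 - x|]gtr0_norm // [`|bintail _ _ _|]ger0_norm ?bintail_ge0 //.
    rewrite ler_pM ?exprn_ge0 ?bintail_ge0 // ?(ltW y0) //.
      by rewrite lerXn2r // nnegrE ltW.
    by apply: le_trans (hN i _ z0) _; rewrite exprMn.
  rewrite normrM normrM normfV !normrX [`|1 - x|]gtr0_norm // -mulrA.
  rewrite ler_pM ?exprn_ge0 ?mulr_ge0 ?invr_ge0 ?exprn_ge0 ?(ltW y0) //.
    by rewrite lerXn2r // nnegrE ltW.
  by rewrite mulrC ler_pdivrMr.
have h1 := HM x (itv_norm_le xx).
have h2 := powR_onep_bounded xx.
have -> : M * 2 * 2 ^+ E * B * (1 - x) `^ a =
  M * 2 * ((1 - x) `^ a * (2 ^+ E * B)) by ring.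
by apply: ler_pM; [rewrite mulr_ge0|rewrite mulr_ge0 ?powR_ge0|exact: ler_pM|
  rewrite ler_wpM2l ?powR_ge0].
Unshelve. all: by end_near. Qed.

Lemma residue_kernel_integral_cvg :
  mu.-integrable `[-1, theta] (EFin \o limit_integrand) /\
  (fun N => \int[mu]_(x in `[-1, 1])
     residue_kernel alpha (T N) s (k N) s' (m N) x) @ \oo -->
  \int[mu]_(x in `[-1, theta]) limit_integrand x.
Proof.
have [C C0 HC] := residue_kernel_bounded.
have [th1 th2] := andP theta1.
pose f x := limit_integrand x * (x < theta)%R%:R.
have fE : f = limit_integrand \_ `]-oo, theta[.
  apply/funext => x; rewrite /f patchE; case: ifPn => xt.
    by move: xt; rewrite inE /= in_itv /= => ->; rewrite mulr1.
  move: xt; rewrite notin_setE /= in_itv /= => /negP/negbTE ->.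
  by rewrite mulr0.
have mf : measurable_fun (`[-1, 1]%classic : set (measurableTypeR R)) f.
  rewrite fE; apply/(measurable_restrict _ _ _).1 => //.
  by apply: measurable_funTS; exact: measurable_limit_integrand.
have gi : mu.-integrable `[-1, 1] (EFin \o (fun x : R => C * (1 - x) `^ a)).
  apply: (@integrable_weight R a (fun=> C) `|C|) => //.
have D1 : measurable (`[-1, 1]%classic : set (measurableTypeR R)) by [].
have DE : `[-1, 1]%classic `&` `]-oo, theta[%classic = `[-1, theta[%classic :> set R.
  apply/seteqP; split=> x /=; rewrite !in_itv /=.
    by move=> [/andP[-> _] ->].
  by move=> /andP[-> xt]; rewrite xt (ltW (lt_le_trans xt th2)).
have [fi cv] := @Rintegral_dominated_cvg R (-1) 1 theta
  (fun N => residue_kernel alpha (T N) s (k N) s' (m N)) f _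
  (fun N => integrable_residue_kernel (T N) s (k N) s' (m N) alpha0) mf gi
  residue_kernel_cvg HC.
have li : mu.-integrable `[-1, theta[ (EFin \o limit_integrand).
  have mP : measurable (`]-oo, theta[%classic : set (measurableTypeR R)) by [].
  rewrite -DE; apply/(integrable_restrict _ mP D1).
  by move: fi; rewrite fE -restrict_EFin.
have li' : mu.-integrable `[-1, theta] (EFin \o limit_integrand).
  (* The degenerate theta = -1 is a genuine case: it serves the regime of determinant 1. *)
  move: th1; rewrite le_eqVlt => /predU1P[<-|th1'].
    rewrite set_itv1; apply: null_set_integrable => //; first exact: measurable_fun_set1.
    exact: lebesgue_measure_set1.
  apply: integrable_itv_cc => //; apply: integrableS li => //.
  by apply: subset_itvr; rewrite bnd_simp.
split => //.
by move: cv; rewrite fE -Rintegral_mkcondr DE Rintegral_itv_bndo_bndc.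
Qed.

Lemma residue_entry_cvg (b : bool) : (forall N, (m N <= k N)%N = b) ->
  (fun N => residue_entry alpha (T N) s (k N) s' (m N)) @ \oo -->
  2 `^ (a + 1 / 2) / pi *
    (- (\int[mu]_(x in `[-1, theta]) limit_integrand x) +
     if b then \int[mu]_(x in `[-1, 1]) limit_integrand x else 0).
Proof.
move=> hb; have [_ cv] := residue_kernel_integral_cvg.
have EN N : residue_entry alpha (T N) s (k N) s' (m N) =
  2 `^ (a + 1 / 2) / pi *
    (- (\int[mu]_(x in `[-1, 1]) residue_kernel alpha (T N) s (k N) s' (m N) x) +
     if b then \int[mu]_(x in `[-1, 1]) limit_integrand x else 0).
  rewrite /residue_entry hb hka hma; congr (_ * (_ + _)).
  have -> : (level_r (k N))%:R - (level_r (m N))%:R = E%:R - D%:R :> R.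
    by apply/eqP; rewrite subr_eq addrAC eq_sym subr_eq -!natrD hkm addnC.
  by [].
under eq_cvg do rewrite EN.
apply: cvgM; first exact: cvg_cst.
by apply: cvgD; [exact: cvgN|exact: cvg_cst].
Qed.

End KernelIntegralLimit.

(** * Limits of the determinants *)

Section Assembly.
Variable R : realType.
Local Notation mu := (@lebesgue_measure R).
Implicit Types (alpha t l a : R).

Lemma level_of_rank (k r : nat) a : a = 1 / 2 \/ a = - (1 / 2) -> (0 < r)%N ->
  k%:R = 2 * r%:R + a - 1 / 2 :> R ->
  [/\ (0 < k)%N, level_r k = r & level_a R k = a].
Proof.
move=> [->|->] r0 hk.
  have {hk}-> : k = r.*2.
    by apply/eqP; rewrite -(eqr_nat R) hk -mul2n natrM; apply/eqP; lra.
  rewrite double_gt0 /level_r /level_a /= odd_double; split => //.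
  by rewrite uphalf_double.
have {hk}-> : k = r.*2.-1.
  apply/eqP; rewrite -(eqr_nat R) -subn1 natrB ?double_gt0 // hk -mul2n natrM.
  by apply/eqP; lra.
case: r r0 => // r _; rewrite doubleS /= /level_r /level_a /= odd_double /=.
by rewrite doubleK.
Qed.

(** The condition is affine in x, and since (1 + alpha)^2 = 1 + 2 c the hypothesis is its weak form
    at x = -1. For l < t, moving away from -1 gains (t - l) c (1 + x). *)
Lemma subcritical_rate alpha t l (x : R) : 0 < alpha -> 0 < t -> 0 < l ->
  (1 - (1 + alpha) ^- 2) * t <= l -> -1 < x <= 1 ->
  t * (phi_rate alpha * (1 - x)) < l * (1 + phi_rate alpha * (1 - x)).
Proof.
move=> a0 t0 l0 h /andP[x1 x2].
have c0 : 0 < phi_rate alpha.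
  by rewrite /phi_rate ltr_wpDr // divr_ge0 // sqr_ge0.
have E : (1 + alpha) ^+ 2 = 1 + 2 * phi_rate alpha by rewrite /phi_rate; field.
rewrite E in h; move: (phi_rate alpha) c0 h => c c0 h {E}.
have p0 : 0 < 1 + 2 * c by lra.
have h' : 2 * c * t <= l * (1 + 2 * c).
  rewrite -ler_pdivrMr //; apply: le_trans h; rewrite le_eqVlt; apply/orP; left.
  by apply/eqP; field; rewrite lt0r_neq0.
have [tl|lt] := leP t l.
  have : 0 <= (l - t) * (c * (1 - x)) by rewrite !mulr_ge0 ?subr_ge0 // ltW.
  lra.
have : 0 < (t - l) * (c * (1 + x)) by rewrite !mulr_gt0 ?subr_gt0 //; lra.
lra.
Qed.

(** Equality of the two rates means 1 - x = l / ((t - l) c), that is, x = theta; the hypothesis on l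
    says that this quotient is below 2. *)
Lemma theta_critical_rate alpha t l (theta : R) : 0 < alpha -> 0 < t -> 0 < l ->
  l < (1 - (1 + alpha) ^- 2) * t ->
  theta = 1 + 2 * l / ((l - t) * (2 * alpha + alpha ^+ 2)) ->
  [/\ -1 < theta < 1,
    (forall x, x < theta ->
       l * (1 + phi_rate alpha * (1 - x)) < t * (phi_rate alpha * (1 - x))) &
    (forall x, theta < x ->
       t * (phi_rate alpha * (1 - x)) < l * (1 + phi_rate alpha * (1 - x)))].
Proof.
move=> a0 t0 l0 h ->.
have c0 : 0 < phi_rate alpha.
  by rewrite /phi_rate ltr_wpDr // divr_ge0 // sqr_ge0.
have E : (1 + alpha) ^+ 2 = 1 + 2 * phi_rate alpha by rewrite /phi_rate; field.
have E2 : 2 * alpha + alpha ^+ 2 = 2 * phi_rate alpha by rewrite /phi_rate; field.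
rewrite E in h; rewrite E2; move: (phi_rate alpha) c0 h => c c0 h {E E2}.
have p0 : 0 < 1 + 2 * c by lra.
have h' : l * (1 + 2 * c) < 2 * c * t.
  rewrite -ltr_pdivlMr //; apply: lt_le_trans h _; rewrite le_eqVlt; apply/orP; left.
  by apply/eqP; field; rewrite lt0r_neq0.
have lt : l < t.
  rewrite -(ltr_pM2l (_ : 0 < 2 * c)); last lra.
  lra.
have tlc : 0 < (t - l) * c by rewrite mulr_gt0 // subr_gt0.
have lt0 : l - t != 0 by rewrite lt_eqF // subr_lt0.
have tl0 : t - l != 0 by rewrite gt_eqF // subr_gt0.
have -> : 1 + 2 * l / ((l - t) * (2 * c)) = 1 - l / ((t - l) * c).
  by field; rewrite lt0 tl0 lt0r_neq0.
have q0 : 0 < l / ((t - l) * c) by rewrite divr_gt0.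
have q2 : l / ((t - l) * c) < 2 by rewrite ltr_pdivrMr //; lra.
split; first by apply/andP; split; lra.
- move=> x xt; have : l / ((t - l) * c) < 1 - x by lra.
  by rewrite ltr_pdivrMr //; lra.
- move=> x xt; have : 1 - x < l / ((t - l) * c) by lra.
  by rewrite ltr_pdivlMr //; lra.
Qed.

Lemma det_cvg (p : nat) (A : nat -> 'M[R]_p) (L : 'M[R]_p) :
  (forall i j, (fun N => A N i j) @ \oo --> L i j) ->
  (fun N => \det (A N)) @ \oo --> \det L.
Proof.
move=> cA; rewrite /determinant; apply: cvg_big => [|s _].
  by move=> y; apply: cvgD; [exact: cvg_fst|exact: cvg_snd].
apply: cvgM; first exact: cvg_cst.
apply: cvg_big => [|i _]; last exact: cA.
by move=> y; apply: cvgM; [exact: cvg_fst|exact: cvg_snd].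
Qed.

Lemma cvg_real_complex (u : nat -> R) (L : R) : u @ \oo --> L ->
  (fun N => (u N)%:C) @ \oo --> (L%:C : R[i]^o).
Proof.
move=> uL; apply/(@cvgrPdist_lt _ (R[i]^o)) => -[e e'] e0.
(* A positive element of the ordered complex field is real, so its real part serves as the
   epsilon. *)
move: (e0); rewrite ltcE /= => /andP[/eqP e'0 epos].
have near_u : \forall N \near \oo, `|L - u N| < e.
  by move/cvgrPdist_lt : uL; exact.
near=> N; rewrite -rmorphB normc_def /= expr0n addr0 sqrtr_sqr e'0.
by rewrite ltcR; near: N.
Unshelve. all: by end_near. Qed.

(** The rows need not be sorted by [k]. A permutation raising [k] somewhere meets a zero entry; one
    never raising it preserves [k], as the sums of [k] agree, and a point it moves then meets an
    off-diagonal zero of a block. *)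
Lemma det_triangular_delta (p : nat) (M : 'M[R]_p) (k : 'I_p -> nat) :
  (forall i j, (k i < k j)%N -> M i j = 0) ->
  (forall i j, k i = k j -> M i j = (i == j)%:R) ->
  \det M = 1.
Proof.
move=> M0 M1; rewrite /determinant (bigD1 (1%g : {perm 'I_p})) //=.
rewrite odd_perm1 expr0 mul1r [X in X + _]big1; last first.
  by move=> i _; rewrite perm1 M1 // eqxx.
rewrite big1 ?addr0 // => s s1.
have [/forallP H|] := boolP [forall i, (k (s i) <= k i)%N]; last first.
  rewrite negb_forall => /existsP[j]; rewrite -ltnNge => h.
  by rewrite (bigD1 j) //= M0 // mul0r mulr0.
have sumk : (\sum_(i < p) k (s i) = \sum_(i < p) k i)%N.
  by rewrite [RHS](reindex_inj (@perm_inj _ s)).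
have keq i : k (s i) = k i.
  apply/eqP; rewrite eqn_leq H /= leqNgt; apply/negP => lt.
  suff : (\sum_(i < p) k (s i) < \sum_(i < p) k i)%N by rewrite sumk ltnn.
  rewrite [X in (X < _)%N](bigD1 i) // [X in (_ < X)%N](bigD1 i) //=.
  by rewrite -addSn leq_add // leq_sum.
have [i si] : exists i, s i != i.
  apply/existsP; rewrite -negb_forall; apply: contra s1 => /forallP h.
  by apply/eqP/permP => i; rewrite perm1; apply/eqP; exact: h.
by rewrite (bigD1 i) //= M1 // eq_sym (negPf si) mul0r mulr0.
Qed.

(** In each term of the Leibniz formula every sign occurs once as a row and once as a column. *)
Lemma det_sign_conj (p : nat) (M : 'M[R]_p) (e : 'I_p -> R) :
  (forall i, e i * e i = 1) ->
  \det (\matrix_(i, j) (e i * e j * M i j)) = \det M.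
Proof.
move=> e1; rewrite /determinant; apply: eq_bigr => s _; congr (_ * _).
transitivity ((\prod_i e i) * (\prod_i e (s i)) * \prod_i M i (s i)).
  by rewrite -!big_split /=; apply: eq_bigr => i _; rewrite mxE.
have <- : \prod_i e i = \prod_i e (s i) by rewrite (reindex_inj (@perm_inj _ s)).
rewrite -big_split /=.
by rewrite big1 ?mul1r // => i _; rewrite e1.
Qed.

End Assembly.

(** * Comparison of the limit entries with the discrete Jacobi kernel *)

Section LimitKernel.
Variable R : realType.
Local Notation mu := (@lebesgue_measure R).
Implicit Types (a x theta : R) (s r D E : nat).

(** A half-integer is not 0. This makes the power of 1 - x vanish at x = 1 by convention, where 0 to
    the power 0 would be 1. *)
Lemma half_integer_neq0 a D E : a = 1 / 2 \/ a = - (1 / 2) ->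
  E%:R - D%:R + a != 0 :> R.
Proof.
move=> ha; apply/eqP => h; case: ha => ha; rewrite ha in h.
  have : ((2 * E).+1)%:R = (2 * D)%:R :> R by rewrite mulrSr !natrM; lra.
  by move/eqP; rewrite eqr_nat => /eqP; lia.
have : (2 * E)%:R = ((2 * D).+1)%:R :> R by rewrite mulrSr !natrM; lra.
by move/eqP; rewrite eqr_nat => /eqP; lia.
Qed.

Lemma limit_integrand1 a a' s s' D E : a = 1 / 2 \/ a = - (1 / 2) ->
  limit_integrand a a' s s' D E 1 = 0.
Proof.
move=> ha; rewrite /limit_integrand subrr powR0 ?mulr0 ?mul0r //.
exact: half_integer_neq0.
Qed.

Lemma integrable_limit_integrand a a' s s' E : a = 1 / 2 \/ a = - (1 / 2) ->
  mu.-integrable `[-1, 1] (EFin \o limit_integrand a a' s s' 0 E).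
Proof.
move=> ha; have := integrable_jacobi_weight
  (jacobi s a * jacobi s' a' * (1 - 'X) ^+ E) ha.
apply: eq_integrable => // x; rewrite inE /= in_itv /= => /andP[x1].
rewrite le_eqVlt => /predU1P[->|x2].
  rewrite limit_integrand1 // subrr powR0 ?mulr0 ?mul0r //.
  by have := half_integer_neq0 0 0 ha; rewrite subrr add0r.
rewrite limit_integrandE // expr0 divr1 !hornerM horner_exp.
rewrite !(hornerD, hornerN, hornerC, hornerX); congr (_%:E); ring.
Qed.

Lemma jacobi_kernel_integrandE a a' s s' (r1 r2 D E : nat) x :
  a = 1 / 2 \/ a = - (1 / 2) -> (r1 + D = r2 + E)%N ->
  x <= 1 -> x < 1 \/ D = 0%N ->
  jacobi_kernel_integrand r1%:Z a s r2%:Z a' s' (1 / 2) x =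
  (-1) ^+ r1 * (-1) ^+ r2 * limit_integrand a a' s s' D E x.
Proof.
move=> ha hr + hx; rewrite le_eqVlt => /predU1P[x1|x1].
  rewrite x1 limit_integrand1 // mulr0 /jacobi_kernel_integrand subrr powR0.
    by rewrite mulr0 mul0r.
  by have := half_integer_neq0 0 0 ha; rewrite subrr add0r.
have y0 : 1 - x != 0 by rewrite gt_eqF // subr_gt0.
have y1 : x - 1 != 0 by rewrite lt_eqF // subr_lt0.
rewrite limit_integrandE // /jacobi_kernel_integrand.
have -> : (x - 1) ^ (r1%:Z - r2%:Z) =
    (-1) ^+ r1 * (-1) ^+ r2 * ((1 - x) ^+ E / (1 - x) ^+ D).
  have -> : (1 - x) ^+ E / (1 - x) ^+ D = (1 - x) ^+ r1 / (1 - x) ^+ r2.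
    apply/eqP; rewrite eqr_div ?expf_neq0 // -!exprD addnC -hr; apply/eqP.
    by congr (_ ^+ _).
  rewrite expfzDr // -exprnN -exprnP.
  have -> : x - 1 = -1 * (1 - x) by ring.
  rewrite !exprMn invfM -exprVn invrN1; ring.
ring.
Qed.

Lemma sign_mul_self (n : nat) : (-1) ^+ n * (-1) ^+ n = 1 :> R.
Proof. by rewrite -exprMn mulrNN mulr1 expr1n. Qed.

(** When [b] holds, the integral over [-1, 1] minus that over [-1, theta] is the one over
    [theta, 1]; the sign comes from (x - 1)^(r1 - r2). *)
Lemma discrete_jacobi_kernelE a a' s s' (r1 r2 : nat) theta (b : bool) :
  a = 1 / 2 \/ a = - (1 / 2) -> a' = 1 / 2 \/ a' = - (1 / 2) ->
  -1 < theta < 1 ->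
  mu.-integrable `[-1, theta] (EFin \o limit_integrand a a' s s' (r2 - r1) (r1 - r2)) ->
  b = (2 * r2%:R + a' <= 2 * r1%:R + a) ->
  discrete_jacobi_kernel r1%:Z a s r2%:Z a' s' (1 / 2) theta =
  (-1) ^+ r1 * (-1) ^+ r2 * (2 `^ (a + 1 / 2) / pi *
    (- (\int[mu]_(x in `[-1, theta])
          limit_integrand a a' s s' (r2 - r1) (r1 - r2) x) +
     if b then \int[mu]_(x in `[-1, 1])
          limit_integrand a a' s s' (r2 - r1) (r1 - r2) x else 0)).
Proof.
move=> ha ha' /andP[th1 th2] li ->; rewrite /discrete_jacobi_kernel.
have hr : (r1 + (r2 - r1) = r2 + (r1 - r2))%N by lia.
case: ifP => [hb|_].
(* As a and a' differ by at most 1, the ordering forces r2 <= r1, so no negative power arises and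
   the integrand is integrable up to 1. *)
- have D0 : (r2 - r1 = 0)%N.
    apply/eqP; rewrite subn_eq0 leqNgt; apply/negP => lt.
    have : r1.+1%:R <= r2%:R :> R by rewrite ler_nat.
    rewrite mulrSr => h; case: ha => ha; case: ha' => ha';
      rewrite ha ha' /intmul /= in hb; lra.
  rewrite D0 in hr li *.
  have li1 := integrable_limit_integrand a' s s' (r1 - r2) ha.
  have D1 : measurable (`[theta, 1]%classic : set (measurableTypeR R)) by [].
  have sub1 : mu.-integrable `[theta, 1]
      (EFin \o limit_integrand a a' s s' 0 (r1 - r2)).
    by apply: integrableS li1 => //; apply: subset_itvr; rewrite bnd_simp ltW.
  have -> : \int[mu]_(x in `[theta, 1])
      jacobi_kernel_integrand r1%:Z a s r2%:Z a' s' (1 / 2) x =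
    \int[mu]_(x in `[theta, 1]) ((-1) ^+ r1 * (-1) ^+ r2 *
      limit_integrand a a' s s' 0 (r1 - r2) x).
    apply: eq_Rintegral => x; rewrite inE /= in_itv /= => /andP[_ x1].
    by apply: jacobi_kernel_integrandE => //; right.
  rewrite RintegralZl // [- _ + _]addrC.
  rewrite (Rintegral_itvB li1) ?bnd_simp ?ltW //.
  rewrite Rintegral_itv_obnd_cbnd; first by ring.
  by apply: integrableS sub1 => //; exact: subset_itv_oc_cc.
- have -> : \int[mu]_(x in `[-1, theta])
      jacobi_kernel_integrand r1%:Z a s r2%:Z a' s' (1 / 2) x =
    \int[mu]_(x in `[-1, theta]) ((-1) ^+ r1 * (-1) ^+ r2 *
      limit_integrand a a' s s' (r2 - r1) (r1 - r2) x).
    apply: eq_Rintegral => x; rewrite inE /= in_itv /= => /andP[_ x1].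
    have x2 := le_lt_trans x1 th2.
    by apply: jacobi_kernel_integrandE => //; [exact: ltW|left].
  by rewrite RintegralZl // addr0; ring.
Qed.

End LimitKernel.

Lemma cvg_to_eq (R : realType) (u : nat -> R) (x y : R) :
  u @ \oo --> x -> x = y -> u @ \oo --> y.
Proof. by move=> h <-. Qed.

Theorem theorem5p2 (R : realType) (q alpha t l theta : R)
    (gamma : R -> R[i]) (p : nat) (a : 'I_p -> R) (s : 'I_p -> nat)
    (T : nat -> nat) (r k : nat -> 'I_p -> nat)
    (hq : 0 < q < 1) (halpha : alpha = 2 * q / (1 - q))
    (ht : 0 < t) (hl : 0 < l)
    (hgamma : encircling_contour gamma)
    (hp : (0 < p)%N)
    (ha : forall i, a i = 1 / 2 \/ a i = - (1 / 2))
    (hT : (fun N => (T N)%:R / N%:R : R) @ \oo --> t)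
    (hr0 : forall N i, (0 < r N i)%N)
    (hr : forall i, (fun N => (r N i)%:R / N%:R : R) @ \oo --> l)
    (hrdiff : forall i j N N',
       (r N i)%:Z - (r N j)%:Z = (r N' i)%:Z - (r N' j)%:Z)
    (hk : forall N j, (k N j)%:R = 2 * (r N j)%:R + a j - 1 / 2 :> R)
    (hdistinct : forall N, injective (fun i => (s i, k N i)))
    (htheta : theta = 1 + 2 * l / ((l - t) * (2 * alpha + alpha ^+ 2))) :
  forall N0 : nat,
  (fun N => \det (\matrix_(i < p, j < p)
     correlation_kernel alpha gamma (T N) (s i) (k N i) (s j) (k N j)))
  @ \oo -->
  (if (1 - (1 + alpha) ^- 2) * t <= l then 1
   else (\det (\matrix_(i < p, j < p)
     discrete_jacobi_kernel (r N0 i)%:Z (a i) (s i)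
       (r N0 j)%:Z (a j) (s j) (1 / 2) theta))%:C : R[i]^o).
Proof.
move=> N0.
have alpha0 : 0 < alpha by rewrite halpha divr_gt0 ?mulr_gt0 ?subr_gt0 //; case/andP: hq.
have lev N j := level_of_rank (ha j) (hr0 N j) (hk N j).
have rC N i j : (r N i + (r N0 j - r N0 i) = r N j + (r N0 i - r N0 j))%N.
  by have := hrdiff i j N N0; lia.
pose b i j := (k N0 j <= k N0 i)%N.
have kE N i j : (k N j <= k N i)%N = (2 * (r N j)%:R + a j <= 2 * (r N i)%:R + a i).
  by rewrite -(ler_nat R) !hk; apply/idP/idP; lra.
(* The order of the levels depends only on the differences of the ranks, hence not on N, and [N0]
   can represent all N. *)
have bE N i j : (k N j <= k N i)%N = b i j.
  rewrite /b !kE; have := congr1 (fun n : nat => n%:R : R) (rC N i j).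
  have := congr1 (fun n : nat => n%:R : R) (rC N0 i j).
  by rewrite !natrD => e1 e2; apply/idP/idP; lra.
pose h i j := limit_integrand (a i) (a j) (s i) (s j)
  (r N0 j - r N0 i) (r N0 i - r N0 j).
pose Me theta0 i j : R := (2 `^ (a i + 1 / 2) / pi *
  (- (\int[lebesgue_measure]_(x in `[-1, theta0]) h i j x) +
   if b i j then \int[lebesgue_measure]_(x in `[-1, 1]) h i j x else 0)).
pose M theta0 : 'M[R]_p := \matrix_(i, j) Me theta0 i j.
have ME theta0 i j : M theta0 i j = Me theta0 i j by rewrite mxE.
pose A N : 'M[R]_p := \matrix_(i, j)
  residue_entry alpha (T N) (s i) (k N i) (s j) (k N j).
have AE : (fun N => \det (\matrix_(i < p, j < p)
     correlation_kernel alpha gamma (T N) (s i) (k N i) (s j) (k N j))) =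
   (fun N => (\det (A N))%:C).
  apply/funext => N; rewrite -det_map_mx; congr (\det _); apply/matrixP => i j.
  by rewrite !mxE correlation_kernelE // ?ltW //; case: (lev N i).
(* Both regimes are instances: [theta0 = theta], and [theta0 = -1], for which [below] is vacuous and
   the integrals over [-1, theta0] vanish. *)
have entry (theta0 : R) (th : -1 <= theta0 <= 1)
    (below : forall x : R, -1 <= x < theta0 ->
      l * (1 + phi_rate alpha * (1 - x)) < t * (phi_rate alpha * (1 - x)))
    (above : forall x : R, theta0 < x <= 1 ->
      t * (phi_rate alpha * (1 - x)) < l * (1 + phi_rate alpha * (1 - x))) :
  (forall i j, lebesgue_measure.-integrable `[-1, theta0] (EFin \o h i j)) /\
  (fun N => \det (A N)) @ \oo --> \det (M theta0).
  have hm j : (fun N => (level_r (k N j))%:R / N%:R : R) @ \oo --> l.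
    have -> : (fun N => (level_r (k N j))%:R / N%:R : R) =
      (fun N => (r N j)%:R / N%:R) by apply/funext => N; case: (lev N j) => _ ->.
    exact: hr.
  have rk i j N : (level_r (k N i) + (r N0 j - r N0 i) =
      level_r (k N j) + (r N0 i - r N0 j))%N.
    by case: (lev N i) => _ -> _; case: (lev N j) => _ -> _.
  have k0 i N : (0 < k N i)%N by case: (lev N i).
  have ka i N : level_a R (k N i) = a i by case: (lev N i).
  split=> [i j|].
    by have [] := residue_kernel_integral_cvg (s i) (s j) (ltW alpha0) hl hT (hm j)
      (k0 i) (rk i j) (ka i) (ka j) th below above.
  refine (@det_cvg R p A (M theta0) _) => i j.
  have AijE : (fun N => A N i j) = (fun N =>
      residue_entry alpha (T N) (s i) (k N i) (s j) (k N j)).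
    by apply/funext => N; rewrite mxE.
  rewrite AijE ME.
  exact: (residue_entry_cvg (ltW alpha0) hl hT (hm j)
      (k0 i) (rk i j) (ka i) (ka j) th below above (fun N => bE N i j)).
rewrite AE; set L := \det (\matrix_(i < p, j < p) discrete_jacobi_kernel _ _ _ _ _ _ _ _).
have -> : (if (1 - (1 + alpha) ^- 2) * t <= l then 1 else L%:C : R[i]^o) =
    (if (1 - (1 + alpha) ^- 2) * t <= l then 1 else L)%:C by case: ifP.
apply: cvg_real_complex; case: ifPn => hlt.
- have [|||_ cv] := entry (-1).
  + by rewrite lexx /=; lra.
  + by move=> x /andP[x1 x2]; move: (le_lt_trans x1 x2); rewrite ltxx.
  + by move=> x x1; exact: subcritical_rate hlt x1.
  suff M1 : \det (M (-1)) = 1 by apply: cvg_to_eq cv M1.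
  apply: (@det_triangular_delta R p _ (k N0)) => i j kij.
    by rewrite ME /Me /b leqNgt kij set_itv1 Rintegral_set1 oppr0 addr0 mulr0.
  rewrite ME /Me /b kij leqnn set_itv1 Rintegral_set1 oppr0 add0r.
  have [[_ ri ai] [_ rj aj]] := (lev N0 i, lev N0 j).
  have rij : r N0 i = r N0 j by rewrite -ri -rj kij.
  have aij : a j = a i by rewrite -ai -aj kij.
  (* Within a block of equal levels the distinctness of the points separates the indices s. *)
  have -> : (i == j) = (s i == s j).
    apply/eqP/eqP => [->//|sij]; apply: (@hdistinct N0); by rewrite sij kij.
  rewrite -(jacobi_orthogonal (s i) (s j) (ha i)); congr (_ * _).
  apply: eq_Rintegral => x _.
  by rewrite /h /limit_integrand rij subnn subrr add0r aij hornerM.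
- rewrite -ltNge in hlt; have [th below above] := theta_critical_rate alpha0 ht hl hlt htheta.
  have [|||hi cv] := entry theta.
  + by case/andP: th => /ltW -> /ltW ->.
  + by move=> x /andP[_]; exact: below.
  + by move=> x /andP[+ _]; exact: above.
  suff LM : L = \det (M theta) by apply: cvg_to_eq cv (esym LM).
  rewrite /L.
  (* The sign (-1)^(r_i - r_j) is split as a product over row and column. *)
  rewrite -(@det_sign_conj R p (M theta) (fun i => (-1) ^+ r N0 i)); last first.
    by move=> i; exact: sign_mul_self.
  congr (\det _); apply/matrixP => i j; rewrite !mxE.
  exact: (discrete_jacobi_kernelE (ha i) (ha j) th (hi i j) (kE N0 i j)).
Qed.
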